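(* Let $\mathscr{S}_Q$ be the set of $\operatorname{SL}(2,\mathbb{N})$-saturated Farey fractions of order $Q$ and $N(Q):=\#\mathscr{S}_Q$. For every $\varepsilon>0$, as $Q\to\infty$, $$N(Q)=\frac{Q^2}{2\zeta(2)}\log(4/3)+O_\varepsilon\big(Q^{7/4+\varepsilon}\big).$$
   Context: $Q$ denotes a positive integer. Let $\mathcal{S}$ be the set of matrices $\begin{pmatrix} a&b\\ c&d\end{pmatrix}\in\operatorname{SL}(2,\mathbb{Z})$ with $a\ge b\ge d\ge 1$ and $a\ge c\ge d$, and let $\mathcal{S}_Q=\{M\in\mathcal{S}:\operatorname{Tr}M\le Q\}$. Define $\Psi:\mathcal{S}\to\mathbb{Q}\cap(0,1]$ by $\Psi\begin{pmatrix} a&b\\ c&d\end{pmatrix}=d/b$. The set of $\operatorname{SL}(2,\mathbb{N})$-saturated Farey fractions of order $Q$ is $\mathscr{S}_Q:=\Psi(\mathcal{S}_Q)$ (a set of rational numbers, without multiplicity). $\zeta$ is the Riemann zeta function. $O_\varepsilon$ means that the implied constant depends only on $\varepsilon$. *)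

(* Defs.v *)
From HB Require Import structures.
From mathcomp Require Import all_boot all_order all_algebra finmap.
From mathcomp Require Import all_classical all_reals all_analysis.
From mathcomp Require Import ring lra.
Set Implicit Arguments.
Unset Strict Implicit.
Unset Printing Implicit Defensive.
Import Order.TTheory GRing.Theory Num.Theory.
Import numFieldNormedType.Exports.
Local Open Scope classical_set_scope.
Local Open Scope ring_scope.

(* Rows and columns are indexed from 0, so that
   (a b; c d) = (M 0 0, M 0 1; M 1 0, M 1 1). *)
Definition saturated_mx : set 'M[int]_2 :=
  [set M | [/\ \det M = 1,
               M 0 0 >= M 0 1, M 0 1 >= M 1 1, M 1 1 >= 1 &
               M 0 0 >= M 1 0 /\ M 1 0 >= M 1 1]].

Definition saturated_mx_le (Q : nat) : set 'M[int]_2 :=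
  [set M | saturated_mx M /\ \tr M <= Q%:Z].

Definition Psi (M : 'M[int]_2) : rat := (M 1 1)%:~R / (M 0 1)%:~R.

Definition saturated_farey (Q : nat) : set rat := Psi @` saturated_mx_le Q.

Lemma finite_saturated_farey (Q : nat) : finite_set (saturated_farey Q).
Proof.
pose f (p : 'I_Q.+1 * 'I_Q.+1) : rat := (p.1 : nat)%:~R / (p.2 : nat)%:~R.
apply: (@sub_finite_set _ _ (f @` setT)); last exact/finite_image/finite_finset.
move=> _ [M [[_ ab bd d1 [ac cd]] trM] <-].
have {}trM : M 0 0 + M 1 1 <= Q%:Z.
  rewrite (_ : M 0 0 + M 1 1 = \tr M)// /mxtrace big_ord_recl big_ord1.
  by congr (_ + M _ _); apply/val_inj.
have d0 : 0 <= M 1 1 by apply: le_trans d1.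
have b0 : 0 <= M 0 1 by apply: le_trans bd.
have hd : (`|M 1%R 1%R|%N < Q.+1)%N.
  rewrite ltnS -lez_nat gez0_abs//; apply: le_trans trM.
  by rewrite lerDr; apply: le_trans ab.
have hb : (`|M 0%R 1%R|%N < Q.+1)%N.
  rewrite ltnS -lez_nat gez0_abs//; apply: le_trans trM.
  by apply: (le_trans ab); rewrite lerDl.
exists (Ordinal hd, Ordinal hb) => //.
rewrite /f /Psi /=; congr (_%:~R / _%:~R); exact: gez0_abs.
Qed.

(* Since the set is finite (above), this is its genuine number of elements. *)
Definition card_saturated_farey (Q : nat) : nat :=
  #|` fset_set (saturated_farey Q)|.

(* The Riemann zeta function on the real half-line s > 1, where its defining
   series converges; only zeta(2) is needed. *)
Definition riemann_zeta (R : realType) (s : R) : R :=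
  limn (series (riemannR s)).

Lemma is_cvg_riemann_zeta2 (R : realType) : cvgn (series (riemannR (2 : R))).
Proof.
have step n : riemannR (2 : R) n <= n.+1%:R^-1 * 2 - n.+2%:R^-1 * 2.
  rewrite /riemannR powR_mulrn//.
  have p1 : (0 : R) < n.+1%:R by rewrite ltr0n.
  have p2 : (0 : R) < n.+2%:R by rewrite ltr0n.
  rewrite -mulrBl.
  have -> : n.+1%:R^-1 - n.+2%:R^-1 = (n.+1%:R * n.+2%:R)^-1 :> R.
    by rewrite -[n.+2]addn1 natrD; field; rewrite -?natr1; lra.
  rewrite mulrC ler_pdivlMr ?mulr_gt0// mulrC ler_pdivrMr ?exprn_gt0//.
  rewrite -[n.+2]addn1 natrD expr2 mulrA [2 * _]mulrC -mulrA ler_pM2l//.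
  have : (1 : R) <= n.+1%:R by rewrite ler1n.
  lra.
apply: nondecreasing_is_cvgn.
  apply/nondecreasing_seqP => n; rewrite /series/= big_nat_recr//= lerDl.
  by rewrite invr_ge0 powR_ge0.
exists 2 => _ [n _ <-].
have : series (riemannR (2 : R)) n <= 2 - n.+1%:R^-1 * 2.
  elim: n => [|n IH]; first by rewrite /series/= big_geq// invr1; lra.
  rewrite seriesSr; by apply: le_trans (lerD IH (step n)) _; rewrite addrA subrK.
by move/le_trans; apply; rewrite gerBl mulr_ge0// invr_ge0.
Qed.

(* Main.v *)
(** A fraction [d / b] in lowest terms with [b >= 2] lies in the set exactly when
    [b + d + e <= Q], where [e] in [1, b - 1] is the inverse of [d] modulo [b]:
    the smallest admissible upper left entry is [a = b + e].  So one counts, for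
    each modulus [b], the points of the modular hyperbola [d e = 1 mod b] in a
    triangle cut out of [0, b)^2.

    For a fixed modulus the finite Fourier transform of the triangle has
    logarithmic mass, and Kloosterman's elementary fourth moment argument gives
    [|K(m, n; c)|^4 <= 2 gcd(n, c) c^3 tau(c)^3].  Hence the count is
    [phi(c) / c^2] times the number of lattice points of the triangle, up to
    [c^(3/4)] times powers of [tau(c)] and [log c].  As [tau(c)^2] is
    at most [log(Q)^3] on average over [c <= Q], the total error is
    [Q^(7/4) log(Q)^5].

    The main term [P(Q) = sum_c phi(c) alpha(Q / c)] is found without Moebius
    inversion.  Since [sum_(d | n) phi(d) = n], the sum of [P(x / k)] over all [k]
    is [sum_n n alpha(x / n)], an elementary expression in harmonic numbers, equal
    to [x^2 log(4/3) / 2 + O(x)].  So [E(x) = P(x) - lambda x^2], with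
    [lambda zeta(2) = log(4/3) / 2], satisfies [sum_k E(x / k) = O(x)];
    subtracting the same relation at [x / 2] leaves the odd [k] only, and since
    [sum k^(-3/2) < 1] over odd [k >= 3], induction gives [E(x) = O(x^(3/2))]. *)

Require Import Defs.
From mathcomp Require Import all_boot all_order all_algebra all_fingroup.
From mathcomp Require Import all_solvable finmap.
From mathcomp Require Import all_classical all_reals all_analysis.
From mathcomp Require Import complex.
From mathcomp Require Import ring lra zify.
Set Implicit Arguments.
Unset Strict Implicit.
Unset Printing Implicit Defensive.
Import Order.TTheory GRing.Theory Num.Theory.
Import numFieldNormedType.Exports.
Local Open Scope ring_scope.

(** * Kloosterman sums over a finite commutative ring *)

Section Annihilator.
Variable A : finComUnitRingType.

Definition annihilator_card (a : A) := #|[set x : A | (a * x == 0)%R]|.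

(** Subtracting one fixed solution carries the fibre injectively into the annihilator of [a]. *)
Lemma card_linear_fiber (a y : A) :
  (#|[set x : A | (a * x == y)%R]| <= annihilator_card a)%N.
Proof.
have [->|[x0]] := set_0Vmem [set x : A | a * x == y]; first by rewrite cards0.
rewrite inE => /eqP ax0; rewrite -(card_imset _ (addIr (- x0))).
apply/subset_leq_card/fintype.subsetP => _ /imsetP[x + ->].
by rewrite !inE mulrBr => /eqP ->; rewrite ax0 subrr.
Qed.

(** Multiplication by [b] sends the annihilator of [a * b] into that of [a], and each of its fibres
    is bounded by [card_linear_fiber]. *)
Lemma annihilator_cardM (a b : A) :
  (annihilator_card (a * b)%R <= annihilator_card a * annihilator_card b)%N.
Proof.
rewrite {1}/annihilator_card -sum1_card.
rewrite (partition_big (fun x => b * x) (mem [set y | (a * y == 0)%R])) /=; last first.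
  by move=> x; rewrite !inE mulrA.
rewrite /annihilator_card -sum_nat_const leq_sum// => y ya.
apply: leq_trans (card_linear_fiber b y); rewrite sum1_card.
by apply/subset_leq_card/fintype.subsetP => x; rewrite !inE => /andP[].
Qed.

Definition pair_sums (p : {unit A} * {unit A}) : A * A :=
  (val p.1 + val p.2, (val p.1)^-1 + (val p.2)^-1)%R.

(** Joint additive energy of the graph of x -> 1/x on the units: the number of quadruples that
    orthogonality leaves in the fourth moment of Kloosterman sums. *)
Definition inverse_energy :=
  (\sum_(p : {unit A} * {unit A}) \sum_(q : {unit A} * {unit A})
    (pair_sums p == pair_sums q))%N.

Lemma inverse_energy_le :
  (inverse_energy <=
   annihilator_card 2%:R * (\sum_a annihilator_card a) ^ 2)%N.
Proof.
set B := [set r : ({unit A} * {unit A}) * ({unit A} * {unit A}) |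
  pair_sums r.1 == pair_sums r.2].
rewrite /inverse_energy pair_big /=.
rewrite (_ : (\sum_p _ = #|B|)%N); last first.
  rewrite -sum1_card [RHS]big_mkcond /=; apply: eq_bigr => p _.
  by rewrite inE; case: (_ == _).
(* The fourth unit is x1 + x2 - x3, so x1 - x3, x2 - x3 and x3 determine the quadruple. *)
pose f (r : ({unit A} * {unit A}) * ({unit A} * {unit A})) : A * A * A :=
  (val r.1.1 - val r.2.1, val r.1.2 - val r.2.1, val r.2.1).
have fI : {in B &, injective f}.
  move=> [[a b] [c d]] [[a' b'] [c' d']]; rewrite !inE !xpair_eqE /f /=.
  move=> /andP[/eqP h1 _] /andP[/eqP h2 _] [e1 e2 e3].
  have ec : c = c' by apply: val_inj.
  have ea : a = a' by apply: val_inj; move: e1 => /=; rewrite e3 => /addIr.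
  have eb : b = b' by apply: val_inj; move: e2 => /=; rewrite e3 => /addIr.
  subst a' b' c'; congr (_, (_, _)); apply: val_inj => /=.
  by apply: (addrI (val c)); rewrite -h1 -h2.
rewrite -(card_in_imset fI).
(* With x1 + x2 = x3 + x4, equality of the sums of inverses amounts to
   (x1 + x2) (x1 - x3) (x2 - x3) = 0; this is linear in x3 once the
   differences x1 - x3 and x2 - x3 are fixed. *)
pose D := [set t : A * A * A |
  (2 * (t.1.1 * t.1.2)) * t.2 == - (t.1.1 * t.1.2 * (t.1.1 + t.1.2))].
apply: (@leq_trans #|D|).
  apply/subset_leq_card/fintype.subsetP => _ /imsetP[[[a b] [c d]] + ->].
  rewrite !inE xpair_eqE /f /= => /andP[/eqP h1 /eqP h2].
  set x1 := val a in h1 h2 *; set x2 := val b in h1 h2 *.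
  set x3 := val c in h1 h2 *; set x4 := val d in h1 h2 *.
  have u1 : x1 \is a GRing.unit := valP a.
  have u2 : x2 \is a GRing.unit := valP b.
  have u3 : x3 \is a GRing.unit := valP c.
  have u4 : x4 \is a GRing.unit := valP d.
  have h3 : (x1 + x2) * (x3 * x4) = (x3 + x4) * (x1 * x2).
    have e1 : (x1^-1 + x2^-1) * (x1 * x2) = x1 + x2.
      by rewrite mulrDl mulrA mulVr// mul1r mulrCA mulVr// mulr1 addrC.
    have e2 : (x3^-1 + x4^-1) * (x3 * x4) = x3 + x4.
      by rewrite mulrDl mulrA mulVr// mul1r mulrCA mulVr// mulr1 addrC.
    by rewrite -e1 -e2 h2; ring.
  have e4 : x4 = x1 + x2 - x3 by rewrite h1; ring.
  rewrite -subr_eq0; apply/eqP; move: h3; rewrite -h1 e4 => /eqP.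
  rewrite -subr_eq0 => /eqP h3.
  by apply: oppr_inj; rewrite oppr0 -[RHS]h3; ring.
have -> : #|D| = (\sum_(ab : A * A) #|[set x : A |
    ((2 * (ab.1 * ab.2)) * x == - (ab.1 * ab.2 * (ab.1 + ab.2)))%R]|)%N.
  rewrite -sum1_card (eq_bigr (fun ab : A * A => \sum_(x : A)
    ((2 * (ab.1 * ab.2)) * x == - (ab.1 * ab.2 * (ab.1 + ab.2)))%R : nat)%N).
    rewrite pair_big /= [LHS]big_mkcond /=; apply: eq_bigr => -[[a b] x] _.
    by rewrite inE /=; case: (_ == _).
  move=> [a b] _; rewrite -sum1_card [LHS]big_mkcond; apply: eq_bigr => x _.
  by rewrite inE /=; case: (_ == _).
(* For fixed differences a and b the equation has leading coefficient 2 a b, so the annihilators of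
   2, a and b bound the number of its solutions; the sum over a and b then factors into a square. *)
rewrite expnS expn1 big_distrlr /= big_distrr /= -(pair_big predT predT
  (fun a b => #|[set x : A | (2 * (a * b)) * x == - (a * b * (a + b))]|)) /=.
apply: leq_sum => a _; rewrite big_distrr /=; apply: leq_sum => b _.
apply: leq_trans (card_linear_fiber _ _) _.
apply: leq_trans (annihilator_cardM _ _) _.
by rewrite leq_mul2l annihilator_cardM orbT.
Qed.

End Annihilator.

Section Kloosterman.
Variables (A : finComUnitRingType) (C : numClosedFieldType) (chi : A -> C).
Hypothesis chiD : forall a b, chi (a + b) = chi a * chi b.
Hypothesis norm_chi : forall a, `|chi a| = 1.
Hypothesis chi_orth : forall b, \sum_a chi (a * b) = (b == 0)%:R * #|A|%:R.

Definition kloosterman (m n : A) : C :=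
  \sum_(x : {unit A}) chi (m * val x + n * (val x)^-1).

Lemma character_neq0 a : chi a != 0.
Proof. by rewrite -normr_eq0 norm_chi oner_neq0. Qed.

Lemma character0 : chi 0 = 1.
Proof.
apply: (mulfI (character_neq0 0)); by rewrite -chiD addr0 mulr1.
Qed.

Lemma conj_character a : (chi a)^* = chi (- a).
Proof.
apply: (mulfI (character_neq0 a)).
by rewrite -normCK norm_chi expr1n -chiD subrr character0.
Qed.

Lemma kloostermanC m n : kloosterman m n = kloosterman n m.
Proof.
rewrite /kloosterman (reindex_inj invg_inj) /=; apply: eq_bigr => x _.
by rewrite invrK addrC.
Qed.

(** The substitution x -> u x permutes the units. *)
Lemma kloosterman_twist m n (u : {unit A}) :
  kloosterman (m * val u) (n * (val u)^-1) = kloosterman m n.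
Proof.
rewrite [RHS]/kloosterman (reindex_inj (mulgI u)) /=; apply: eq_bigr => x _.
by rewrite invrM ?(valP u) ?(valP x)// !mulrA [n * _ * _]mulrAC.
Qed.

(** The fourth power expands over two pairs of units; orthogonality in m keeps those with equal
    sums, orthogonality in n those with equal sums of inverses. *)
Lemma kloosterman_fourth_moment :
  \sum_m \sum_n `|kloosterman m n| ^+ 4 = #|A|%:R ^+ 2 *
    (inverse_energy A)%:R.
Proof.
pose s (p : {unit A} * {unit A}) : A := val p.1 + val p.2.
pose t (p : {unit A} * {unit A}) : A := (val p.1)^-1 + (val p.2)^-1.
have K2 m n : kloosterman m n ^+ 2 =
    \sum_(p : {unit A} * {unit A}) chi (m * s p + n * t p).
  rewrite expr2 big_distrlr pair_big /=; apply: eq_bigr => p _.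
  by rewrite -chiD; congr chi; rewrite /s /t !mulrDr addrACA.
have K4 m n : `|kloosterman m n| ^+ 4 =
    \sum_p \sum_q chi (m * (s p - s q)) * chi (n * (t p - t q)).
  rewrite (exprM _ 2 2) -normrX normCK K2 rmorph_sum big_distrlr /=.
  apply: eq_bigr => p _; apply: eq_bigr => q _.
  by rewrite conj_character -!chiD; congr chi; rewrite !mulrBr opprD addrACA.
under eq_bigr => m _ do under eq_bigr => n _ do rewrite K4.
under eq_bigr => m _ do rewrite exchange_big.
rewrite exchange_big natr_sum big_distrr /=; apply: eq_bigr => p _.
under eq_bigr => m _ do rewrite exchange_big.
rewrite exchange_big natr_sum big_distrr /=; apply: eq_bigr => q _.
under eq_bigr => m _ do rewrite -big_distrr.
rewrite -big_distrl /= !chi_orth !subr_eq0 xpair_eqE -/(s p) -/(s q) -/(t p) -/(t q).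
by case: (_ == _); case: (_ == _); rewrite ?mul0r ?mulr0// !mul1r mulr1 expr2.
Qed.

(* The sum is constant along the orbit (m u, n / u), u a unit, so that it is
   counted about #|{unit A}| times in the fourth moment. *)
Lemma kloosterman_bound m n :
  #|{: {unit A}}|%:R * `|kloosterman m n| ^+ 4 <= (annihilator_card n)%:R *
    (#|A| ^ 2 * (annihilator_card (2%:R : A)%R * (\sum_(a : A) annihilator_card a) ^ 2))%N%:R.
Proof.
pose F m' n' : C := `|kloosterman m' n'| ^+ 4.
have F0 m' n' : 0 <= F m' n' by rewrite exprn_ge0.
apply: (@le_trans _ _ ((annihilator_card n)%:R * \sum_m' \sum_n' F m' n')); last first.
  rewrite ler_wpM2l ?ler0n// kloosterman_fourth_moment natrM natrX.
  by rewrite ler_wpM2l ?exprn_ge0 ?ler0n// ler_nat inverse_energy_le.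
have -> : #|{: {unit A}}|%:R * `|kloosterman m n| ^+ 4 =
    \sum_(u : {unit A}) F (m * val u) (n * (val u)^-1).
  under eq_bigr => u _ do rewrite /F kloosterman_twist.
  by rewrite sumr_const mulr_natl.
rewrite (partition_big (fun u : {unit A} => (m * val u, n * (val u)^-1)) predT)//=.
rewrite pair_big /= big_distrr /=; apply: ler_sum => -[m' n'] _ /=.
rewrite (eq_bigr (fun=> F m' n')) => [|u /eqP[-> ->]//].
rewrite sumr_const -[_ *+ _]mulr_natl ler_wpM2r ?F0// ler_nat.
(* Units u in the fibre over (m', n') satisfy n / u = n', so their inverses solve one linear
   equation with coefficient n. *)
apply: leq_trans (card_linear_fiber n n').
have invI : injective (fun u : {unit A} => (val u)^-1).
  by move=> u v /(can_inj (@invrK _))/val_inj.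
rewrite -(card_imset _ invI).
apply/subset_leq_card/fintype.subsetP => _ /imsetP[u + ->].
by rewrite unfold_in inE /= => /andP[_].
Qed.

Definition fourier (f : A -> A -> C) (m n : A) : C :=
  \sum_x \sum_y f x y * chi (- (m * x + n * y)).

(** A Parseval identity: the Kloosterman sums are the Fourier coefficients of the indicator of the
    points (u, 1/u), and orthogonality in m and n forces x = u and y = 1/u. *)
Lemma sum_fourier_kloosterman f :
  \sum_m \sum_n fourier f m n * kloosterman m n =
  #|A|%:R ^+ 2 * \sum_(u : {unit A}) f (val u) (val u)^-1.
Proof.
have E m n : fourier f m n * kloosterman m n =
    \sum_(u : {unit A}) \sum_x \sum_y
      f x y * (chi (m * (val u - x)) * chi (n * ((val u)^-1 - y))).
  rewrite /kloosterman big_distrr /=; apply: eq_bigr => u _.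
  rewrite /fourier big_distrl /=; apply: eq_bigr => x _.
  rewrite big_distrl /=; apply: eq_bigr => y _.
  by rewrite -mulrA -!chiD; congr (_ * chi _); ring.
under eq_bigr => m _ do under eq_bigr => n _ do rewrite E.
under eq_bigr => m _ do rewrite exchange_big.
rewrite exchange_big big_distrr /=; apply: eq_bigr => u _.
transitivity (\sum_x \sum_y f x y *
    ((\sum_m chi (m * (val u - x))) * (\sum_n chi (n * ((val u)^-1 - y))))).
  under eq_bigr => m _ do rewrite exchange_big.
  rewrite exchange_big; apply: eq_bigr => x _.
  under eq_bigr => m _ do rewrite exchange_big.
  rewrite exchange_big; apply: eq_bigr => y _.
  rewrite big_distrlr /= big_distrr /=; apply: eq_bigr => m _.
  by rewrite big_distrr.
rewrite (bigD1 (val u))//= [X in _ + X]big1 ?addr0; last first.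
  move=> x xu; rewrite big1// => y _.
  by rewrite !chi_orth subr_eq0 eq_sym (negPf xu) !(mul0r, mulr0).
rewrite (bigD1 (val u)^-1)//= [X in _ + X]big1 ?addr0; last first.
  move=> y yu; rewrite !chi_orth [_^-1 - y == 0]subr_eq0 [_^-1 == y]eq_sym.
  by rewrite (negPf yu) !(mul0r, mulr0).
by rewrite !chi_orth !subrr !eqxx !mul1r mulrC expr2.
Qed.

Lemma fourierC f : (forall x y, f x y = f y x) ->
  forall m n, fourier f m n = fourier f n m.
Proof.
move=> fC m n; rewrite /fourier exchange_big; apply: eq_bigr => x _.
by apply: eq_bigr => y _; rewrite fC addrC.
Qed.

(** The frequency (0, 0) gives the expected count, and all others are error. The majorant of the
    Fourier coefficients has the shape found for a triangle; it requires n != 0, and symmetry of [f]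
    covers the remaining frequencies. *)
Lemma inverse_graph_discrepancy (f : A -> A -> C) (w G k : A -> C) (beta : C) :
    (forall x y, f x y = f y x) ->
    (forall a, 0 <= w a) -> (forall a, 0 <= G a) ->
    (forall a, 0 <= k a) -> 0 <= beta ->
    (forall m n, n != 0 -> `|fourier f m n| <= w n * (G m + G (m - n))) ->
    (forall m n, n != 0 -> `|kloosterman m n| <= beta * k n) ->
  `|#|A|%:R ^+ 2 * (\sum_(u : {unit A}) f (val u) (val u)^-1) -
    #|{: {unit A}}|%:R * \sum_x \sum_y f x y| <=
  4 * beta * (\sum_a G a) * \sum_(n | n != 0) w n * k n.
Proof.
move=> fC w0 G0 k0 b0 hf hK; set S := \sum_a G a; set W := \sum_(n | n != 0) w n * k n.
have S0 : 0 <= S by apply: sumr_ge0.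
pose T m n := fourier f m n * kloosterman m n.
have TC m n : T m n = T n m by rewrite /T fourierC// kloostermanC.
have T00 : T 0 0 = #|{: {unit A}}|%:R * \sum_x \sum_y f x y.
  rewrite /T mulrC; congr (_ * _).
    rewrite /kloosterman; under eq_bigr => x _ do rewrite !mul0r addr0 character0.
    by rewrite sumr_const.
  apply: eq_bigr => x _; apply: eq_bigr => y _.
  by rewrite !mul0r addr0 oppr0 character0 mulr1.
have GS a : G a <= S by rewrite /S (bigD1 a)//= lerDl sumr_ge0.
have hT m n : n != 0 -> `|T m n| <= beta * (w n * k n) * (G m + G (m - n)).
  move=> n0; rewrite normrM.
  apply: le_trans (ler_pM _ _ (hf m n n0) (hK m n n0)) _ => //.
  rewrite le_eqVlt; apply/orP; left; apply/eqP; ring.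
(* The nonzero frequencies are those with n != 0 and any m, followed by the (m, 0) with m != 0,
   which are transposed. Each of the two families contributes one half of the final bound. *)
have -> : #|A|%:R ^+ 2 * (\sum_(u : {unit A}) f (val u) (val u)^-1) -
    #|{: {unit A}}|%:R * (\sum_x \sum_y f x y) =
    \sum_(n | n != 0) \sum_m T m n + \sum_(m | m != 0) T 0 m.
  rewrite -sum_fourier_kloosterman -T00 exchange_big (bigD1 0)//=.
  rewrite (bigD1 0)//= -/(T 0 0) addrC [T 0 0 + _]addrC addrA addrK.
  by congr (_ + _); apply: eq_bigr => m _; rewrite -/(T m 0) TC.
have -> : 4 * beta * S * W = 2 * beta * S * W + 2 * beta * S * W by ring.
apply: le_trans (ler_normD _ _) _; apply: lerD.
  apply: le_trans (ler_norm_sum _ _ _) _; rewrite big_distrr /=.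
  apply: ler_sum => n n0; apply: le_trans (ler_norm_sum _ _ _) _.
  apply: le_trans (ler_sum _ (fun m _ => hT m n n0)) _.
  rewrite -big_distrr /= big_split /=.
  have -> : \sum_m G (m - n) = S.
    by rewrite /S [RHS](reindex_inj (addIr (- n))).
  rewrite -/S le_eqVlt; apply/orP; left; apply/eqP; ring.
apply: le_trans (ler_norm_sum _ _ _) _; rewrite big_distrr /=.
apply: ler_sum => n n0; apply: le_trans (hT 0 n n0) _.
have -> : 2 * beta * S * (w n * k n) = beta * (w n * k n) * (S + S) by ring.
by rewrite ler_wpM2l ?mulr_ge0// lerD.
Qed.

End Kloosterman.

(** * Divisor sums and Euler's totient *)

Section TotientDivisors.
Local Open Scope nat_scope.

Lemma sum_multiples (V : nmodType) (F : nat -> V) g q : 0 < g ->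
  (\sum_(0 <= h < q * g | (g %| h)%N) F h = \sum_(0 <= j < q) F (j * g)%N)%R.
Proof.
move=> g0; elim: q => [|q IH]; first by rewrite mul0n !big_geq.
rewrite (@big_cat_nat _ _ _ (q * g)) ?leq_mul2r ?leqnSn ?orbT//= IH.
rewrite [RHS]big_nat_recr//=; congr (_ + _)%R.
rewrite big_ltn_cond ?ltn_mul2r ?g0 ?leqnn// dvdn_mull// big1_seq ?addr0//.
move=> i; rewrite mem_index_iota mulSn => /and3P[/dvdnP[k ->]].
by rewrite -mulSn !ltn_mul2r g0 ltnS /= => qk; rewrite leqNgt qk.
Qed.

Lemma leq_gcd_sum_divisors h c : 0 < c ->
  gcdn h c <= \sum_(g <- divisors c | g %| h) g.
Proof.
move=> c0; rewrite big_mkcond (bigD1_seq (gcdn h c))/= ?divisors_uniq//; last first.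
  by rewrite -dvdn_divisors// dvdn_gcdr.
by rewrite dvdn_gcdl leq_addr.
Qed.

(** With the gcd bounded by the sum of all common divisors g, each divisor g of c contributes g for
    each of its c / g multiples. *)
Lemma sum_gcd_le c : 0 < c -> \sum_(0 <= h < c) gcdn h c <= c * size (divisors c).
Proof.
move=> c0; apply: (@leq_trans (\sum_(0 <= h < c) \sum_(g <- divisors c | g %| h) g)).
  by apply: leq_sum => h _; exact: leq_gcd_sum_divisors.
under eq_bigr => h _ do rewrite big_mkcond /=.
rewrite exchange_big /= mulnC -sum1_size big_distrl /=.
rewrite big_seq [leqRHS]big_seq; apply: leq_sum => g.
rewrite -dvdn_divisors// => gc; have g0 := dvdn_gt0 c0 gc.
rewrite -big_mkcond /= -{1}(divnK gc) (sum_multiples (fun=> g) _ g0).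
by rewrite sum_nat_const_nat subn0 mul1n divnK.
Qed.

(** The same expansion: on the multiples h = j g the quotient g / h is 1 / j, so each divisor
    contributes at most the full harmonic sum. *)
Lemma sum_gcd_div_le (F : numFieldType) c : 0 < c ->
  (\sum_(1 <= h < c) (gcdn h c)%:R / h%:R <=
   (size (divisors c))%:R * \sum_(1 <= h < c) h%:R^-1 :> F)%R.
Proof.
move=> c0; apply: (@le_trans _ _ (\sum_(g <- divisors c)
    \sum_(1 <= h < c | (g %| h)%N) (g%:R / h%:R : F))%R).
  under [leRHS]eq_bigr => g _ do rewrite big_mkcond /=.
  rewrite exchange_big /= big_nat [leRHS]big_nat; apply: ler_sum => h /andP[h0 _].
  rewrite -big_mkcond /= -big_distrl /= ler_wpM2r ?invr_ge0 ?ler0n//.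
  by rewrite -natr_sum ler_nat leq_gcd_sum_divisors.
rewrite -sum1_size natr_sum big_distrl /= big_seq [leRHS]big_seq; apply: ler_sum => g.
rewrite -dvdn_divisors// => gc; have g0 := dvdn_gt0 c0 gc; rewrite mul1r.
(* The index h = 0 may be added because the inverse of 0 is 0. *)
have -> : (\sum_(1 <= h < c | (g %| h)%N) (g%:R / h%:R) =
    \sum_(0 <= h < c | (g %| h)%N) (g%:R / h%:R) :> F)%R.
  by rewrite [RHS]big_ltn_cond//= dvdn0 invr0 mulr0 add0r.
rewrite -{1}(divnK gc) (sum_multiples (fun h => g%:R / h%:R)%R _ g0).
have cg0 : 0 < c %/ g by rewrite divn_gt0// dvdn_leq.
rewrite [leLHS]big_ltn// mul0n invr0 mulr0 add0r.
rewrite [leRHS](@big_cat_nat _ _ _ (c %/ g) 1 c _ _ cg0 (leq_div c g)) /=.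
have rest0 : (0 <= \sum_(c %/ g <= h < c) h%:R^-1 :> F)%R.
  by apply: sumr_ge0 => i _; rewrite invr_ge0 ler0n.
rewrite ler_wpDr//.
apply: ler_sum => j _; rewrite natrM invfM mulrCA mulfV ?mulr1//.
by rewrite pnatr_eq0 -lt0n.
Qed.

Lemma totient_mul_prime p m : prime p -> 0 < m -> totient m <= totient (p * m).
Proof.
move=> pp m0; have p0 := prime_gt0 pp.
have [m' pm' em] := pfactor_coprime pp m0.
set e := logn p m in em.
have cop k : coprime m' (p ^ k) by rewrite coprimeXr// coprime_sym.
rewrite {2}em mulnCA -expnS {1}em !totient_coprime// leq_mul2l; apply/orP; right.
case: e {em} => [|e]; first by rewrite totient_gt0 expn_gt0 p0.
by rewrite !totient_pfactor//= leq_mul2l leq_pexp2l ?orbT.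
Qed.

(** Strong induction on the cofactor, removing its smallest prime factor. *)
Lemma totient_dvd_le m n : 0 < n -> m %| n -> totient m <= totient n.
Proof.
move=> n0 /dvdnP[k en]; subst n; move: n0; rewrite muln_gt0 => /andP[k0 m0].
elim/ltn_ind: k k0 => k IH k0.
have [k1|k1] := leqP k 1; first by rewrite (_ : k = 1) ?mul1n//; lia.
have pp := pdiv_prime k1; have p1 := prime_gt1 pp.
have ek : k = pdiv k * (k %/ pdiv k) by rewrite mulnC divnK// pdiv_dvd.
have q0 : 0 < k %/ pdiv k by rewrite divn_gt0 ?prime_gt0// pdiv_leq.
apply: leq_trans (IH (k %/ pdiv k) _ q0) _; first by rewrite ltn_Pdiv.
  have -> : k * m = pdiv k * (k %/ pdiv k * m) by rewrite mulnA -ek.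
  by rewrite totient_mul_prime// muln_gt0 q0.
Qed.

(** In the identity sum_(d | c) phi(d) = c every term is at most phi(c). This replaces a lower bound
    for phi(c) at the price of a factor tau(c). *)
Lemma leq_totient_divisors c : 0 < c -> c <= totient c * size (divisors c).
Proof.
move=> c0; rewrite -{1}(sum_totient_dvd c) mulnC -sum1_size big_distrl /=.
rewrite -(big_mkord (fun d => d %| c) totient) -big_filter.
rewrite (perm_big (divisors c)); last first.
  apply: uniq_perm => [||d]; [exact: filter_uniq (iota_uniq _ _)|exact: divisors_uniq|].
  rewrite mem_filter mem_index_iota -dvdn_divisors//= ltnS.
  by case dc: (d %| c) => //=; rewrite dvdn_leq.
rewrite big_seq [leqRHS]big_seq; apply: leq_sum => d; rewrite -dvdn_divisors// => dc.
by rewrite mul1n totient_dvd_le.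
Qed.

End TotientDivisors.

(** * The modular hyperbola in a triangle *)

Section TriangleSums.
Variable C : numClosedFieldType.

(* Bound for the sum of at most c consecutive powers of u. *)
Definition geometric_bound (c : nat) (u : C) : C :=
  if u == 1 then c%:R else 2 / `|u - 1|.

Lemma norm_geometric_sum (u : C) (c p q : nat) : `|u| = 1 -> (q <= c)%N ->
  `|\sum_(p <= x < q) u ^+ x| <= geometric_bound c u.
Proof.
move=> u1 qc; rewrite /geometric_bound; case: eqP => [->|/eqP un1].
  under eq_bigr => x _ do rewrite expr1n.
  rewrite sumr_const_nat normr_nat ler_nat.
  by rewrite (leq_trans (leq_subr _ _)).
have u10 : 0 < `|u - 1| by rewrite normr_gt0 subr_eq0.
rewrite ler_pdivlMr// -normrM big_distrl /=.
have [pq|qp] := leqP p q; last by rewrite big_geq ?normr0 ?ler0n// ltnW.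
under eq_bigr => x _ do rewrite mulrBr mulr1 -exprSr.
rewrite telescope_sumr//; apply: le_trans (ler_normB _ _) _.
by rewrite !normrX u1 !expr1n.
Qed.

(** Multiplication by v - 1 telescopes the sum over y; what remains is a difference of geometric
    sums in x with ratios w / v and w. *)
Lemma norm_triangle_sum (c s : nat) (v w : C) :
    v ^+ c = 1 -> v != 1 -> `|v| = 1 -> `|w| = 1 ->
  `|\sum_(0 <= x < c) \sum_(0 <= y < c) (x + y < s)%N%:R * (w ^+ x * v ^+ y)| <=
  (geometric_bound c w + geometric_bound c (w / v)) / `|v - 1|.
Proof.
move=> vc v1 nv nw.
have v0 : v != 0 by rewrite -normr_eq0 nv oner_neq0.
have v10 : 0 < `|v - 1| by rewrite normr_gt0 subr_eq0.
rewrite ler_pdivlMr// -normrM big_distrl /=.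
have inner x : (\sum_(0 <= y < c) (x + y < s)%N%:R * (w ^+ x * v ^+ y)) * (v - 1) =
    w ^+ x * (v ^+ minn c (s - x) - 1).
  have -> : \sum_(0 <= y < c) (x + y < s)%N%:R * (w ^+ x * v ^+ y) =
      w ^+ x * \sum_(0 <= y < minn c (s - x)) v ^+ y.
    rewrite (big_nat_widen _ _ _ _ _ (geq_minl c (s - x))) big_distrr /=.
    rewrite [RHS]big_mkcond big_nat [RHS]big_nat; apply: eq_bigr => y /andP[_ yc].
    by rewrite leq_min yc ltn_subRL /=; case: ltnP; rewrite ?mul1r ?mul0r.
  rewrite -mulrA; congr (_ * _); rewrite big_distrl /=.
  under eq_bigr => y _ do rewrite mulrBr mulr1 -exprSr.
  by rewrite telescope_sumr.
under eq_bigr => x _ do rewrite inner.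
(* Only p <= x < q contributes: for larger x the row is empty, and for smaller x it is a full
   period, which vanishes because v ^ c = 1. *)
set q := minn s c; set p := minn (s - c) q.
have pq : (p <= q)%N by rewrite geq_minr.
have qc : (q <= c)%N by rewrite geq_minr.
rewrite (big_cat_nat (n := q))//= [X in _ + X]big1_seq ?addr0; last first.
  move=> x /andP[_]; rewrite mem_index_iota /q => hx.
  by rewrite (_ : minn _ _ = 0%N) ?expr0 ?subrr ?mulr0//; lia.
rewrite (big_cat_nat (n := p))//= big1_seq ?add0r; last first.
  move=> x /andP[_]; rewrite mem_index_iota /p => hx.
  by rewrite (_ : minn _ _ = c) ?vc ?subrr ?mulr0//; lia.
have -> : \sum_(p <= x < q) w ^+ x * (v ^+ minn c (s - x) - 1) =
    v ^+ s * (\sum_(p <= x < q) (w / v) ^+ x) - \sum_(p <= x < q) w ^+ x.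
  rewrite big_distrr -sumrB /= big_nat [RHS]big_nat; apply: eq_bigr => x.
  rewrite /p /q => hx; rewrite (_ : minn _ _ = (s - x)%N); last by lia.
  rewrite mulrBr mulr1; congr (_ - _).
  rewrite expr_div_n -[in RHS](@subnK x s); last by lia.
  by rewrite exprD -mulrA [v ^+ x * _]mulrCA mulfV ?expf_neq0// mulr1 mulrC.
apply: le_trans (ler_normB _ _) _; rewrite addrC normrM normrX nv expr1n mul1r.
by apply: lerD; apply: norm_geometric_sum => //; rewrite normf_div nv nw divr1.
Qed.
End TriangleSums.

(** * Kloosterman sums and triangle sums modulo c *)

Section ModularKloosterman.
Variables (C : numClosedFieldType) (c' : nat) (z : C).
Local Notation c := c'.+2.
Hypothesis prim_z : c.-primitive_root z.

Definition root_char (a : 'I_c) : C := z ^+ a.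

Lemma norm_prim_root : `|z| = 1.
Proof.
apply/eqP; rewrite -(@pexpr_eq1 _ _ c)//; apply/eqP.
by rewrite -normrX (prim_expr_order prim_z) normr1.
Qed.

Lemma root_charD a b : root_char (a + b) = root_char a * root_char b.
Proof. by rewrite /root_char /= (prim_expr_mod prim_z) exprD. Qed.

Lemma norm_root_char a : `|root_char a| = 1.
Proof. by rewrite normrX norm_prim_root expr1n. Qed.

Lemma root_char_eq1 a : (root_char a == 1) = (a == 0).
Proof.
rewrite -[1](expr0 z) (eq_prim_root_expr prim_z) mod0n modn_small//.
Qed.

Lemma root_char_mulrn a k : root_char (a *+ k) = root_char a ^+ k.
Proof.
elim: k => [|k IH]; first by rewrite mulr0n expr0 /root_char expr0.
by rewrite mulrS exprS root_charD IH.
Qed.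

Lemma root_char_mul a b : root_char (a * b) = root_char a ^+ b.
Proof. by rewrite -{1}(natr_Zp b) mulr_natr root_char_mulrn. Qed.

Lemma root_char_orth b : \sum_a root_char (a * b) = (b == 0)%:R * #|{: 'I_c}|%:R.
Proof.
case: eqP => [->|/eqP b0].
  under eq_bigr => a _ do rewrite mulr0 /root_char expr0.
  by rewrite sumr_const mul1r.
rewrite mul0r; have : (\sum_a root_char (a * b)) * (root_char b - 1) = 0.
  rewrite mulrBr mulr1 {2}(reindex_inj (addIr 1)) /= big_distrl -sumrB /=.
  by rewrite big1// => a _; rewrite -root_charD mulrDl mul1r subrr.
by move/eqP; rewrite mulf_eq0 subr_eq0 root_char_eq1 (negPf b0) orbF => /eqP.
Qed.

(** If c divides a x, then c / gcd(a, c) divides x, and [0, c) contains gcd(a, c) such multiples. *)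
Lemma annihilator_card_Zp (a : 'I_c) : (annihilator_card a <= gcdn a c)%N.
Proof.
have g0 : (0 < gcdn a c)%N by rewrite gcdn_gt0 orbT.
set q := (c %/ gcdn a c)%N.
have q0 : (0 < q)%N by rewrite divn_gt0// dvdn_leq// dvdn_gcdr.
have cq : (gcdn a c * q = c)%N by rewrite mulnC divnK// dvdn_gcdr.
rewrite /annihilator_card -sum1_card.
have -> : (gcdn a c = \sum_(0 <= h < gcdn a c * q | q %| h) 1)%N.
  by rewrite (sum_multiples (fun=> 1%N) _ q0) sum_nat_const_nat subn0 muln1.
rewrite cq big_mkord; rewrite [leqLHS]big_mkcond [leqRHS]big_mkcond /=.
apply: leq_sum => x _; rewrite inE; case: eqP => // /(congr1 val) /= /eqP.
rewrite -/(dvdn _ _) => cax; suff -> : (q %| x)%N by [].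
have : (q * gcdn a c %| a * x)%N by rewrite mulnC cq.
rewrite -{2}(divnK (dvdn_gcdl a c)) mulnAC dvdn_pmul2r// Gauss_dvdr//.
by rewrite /q coprime_sym /coprime -(eqn_pmul2r g0) mul1n muln_gcdl !divnK ?dvdn_gcdl ?dvdn_gcdr.
Qed.

Lemma sum_annihilator_card :
  (\sum_(a : 'I_c) annihilator_card a <= c * size (divisors c))%N.
Proof.
apply: leq_trans (sum_gcd_le (isT : (0 < c)%N)); rewrite big_mkord.
by apply: leq_sum => a _; exact: annihilator_card_Zp.
Qed.

Lemma annihilator_card2 : (annihilator_card (2%:R : 'I_c)%R <= 2)%N.
Proof.
apply: leq_trans (annihilator_card_Zp _) _.
by rewrite Zp_nat /= gcdn_modl dvdn_leq// dvdn_gcdl.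
Qed.

Lemma card_unit_Zp : #|{: {unit 'I_c}}| = totient c.
Proof. by rewrite -(@card_units_Zp c)// cardsT. Qed.

(** In [kloosterman_bound] the factor phi(c) is traded for c through c <= phi(c) tau(c), which
    supplies the third factor tau(c); gcd <= gcd^4 then permits comparing fourth powers. Giving
    [beta] by its fourth power avoids extracting a root in [C]. *)
Lemma kloosterman_le beta : 0 <= beta ->
    beta ^+ 4 = 2 * c%:R ^+ 3 * (size (divisors c))%:R ^+ 3 ->
  forall m n, `|kloosterman root_char m n| <= beta * (gcdn n c)%:R.
Proof.
move=> b0 b4 m n; set d : C := (size (divisors c))%:R in b4 *.
have d0 : 0 <= d by rewrite ler0n.
have c0 : 0 < c%:R :> C by rewrite ltr0n.
set K := `|_|; have K0 : 0 <= K by rewrite normr_ge0.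
have g1 : 1 <= (gcdn n c)%:R :> C by rewrite ler1n gcdn_gt0 orbT.
have h := kloosterman_bound root_charD norm_root_char root_char_orth m n.
rewrite -/K card_unit_Zp card_ord in h.
have {}h : (totient c)%:R * K ^+ 4 <= (gcdn n c)%:R * (2 * c%:R ^+ 4 * d ^+ 2).
  apply: le_trans h _; apply: ler_pM; rewrite ?ler0n// ?ler_nat ?annihilator_card_Zp//.
  have -> : 2 * c%:R ^+ 4 * d ^+ 2 = (c ^ 2 * (2 * (c * size (divisors c)) ^ 2))%N%:R.
    by rewrite natrM natrX natrM natrX natrM -/d; ring.
  rewrite ler_nat leq_mul2l leq_mul ?annihilator_card2 ?orbT//.
  by rewrite leq_exp2r// sum_annihilator_card.
rewrite -(@ler_pXn2r _ 4)// ?nnegrE ?mulr_ge0 ?ler0n// exprMn b4.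
have {}h : c%:R * K ^+ 4 <= c%:R * ((gcdn n c)%:R * (2 * c%:R ^+ 3 * d ^+ 3)).
  apply: le_trans (_ : (totient c)%:R * K ^+ 4 * d <= _).
    rewrite mulrAC ler_wpM2r ?exprn_ge0// -natrM ler_nat.
    exact: leq_totient_divisors.
  apply: le_trans (ler_wpM2r d0 h) _; rewrite le_eqVlt; apply/orP; left.
  by apply/eqP; ring.
rewrite ler_pM2l// in h; apply: le_trans h _; rewrite mulrC ler_wpM2l//.
  by rewrite !mulr_ge0 ?exprn_ge0 ?ler0n.
by rewrite ler_eXnr.
Qed.

Hypothesis norm_z_sub1 : forall h, (0 < h)%N -> (h.*2 <= c)%N ->
  h%:R <= c%:R * `|z ^+ h - 1|.

(** One of h and c - h is at most c / 2, and z^(c - h), the inverse of z^h, is equally far from 1.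
    Adding both bounds removes the case distinction. *)
Lemma invr_norm_z_sub1 h : (0 < h < c)%N ->
  `|z ^+ h - 1|^-1 <= c%:R / h%:R + c%:R / (c - h)%:R.
Proof.
move=> /andP[h0 hc].
have P k : (0 < k)%N -> (k.*2 <= c)%N -> `|z ^+ k - 1|^-1 <= c%:R / k%:R.
  move=> k0 kc; have := norm_z_sub1 k0 kc => hk.
  have p : 0 < `|z ^+ k - 1|.
    rewrite -(pmulr_rgt0 _ (_ : 0 < c%:R)) ?ltr0n//; apply: lt_le_trans hk.
    by rewrite ltr0n.
  by rewrite ler_pdivlMr ?ltr0n// mulrC ler_pdivrMr.
have [hle|hgt] := leqP h.*2 c.
  by apply: le_trans (P h h0 hle) _; rewrite lerDl divr_ge0 ?ler0n.
have -> : `|z ^+ h - 1| = `|z ^+ (c - h) - 1|.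
  have e : z ^+ h * z ^+ (c - h) = 1.
    by rewrite -exprD subnKC ?(ltnW hc)// (prim_expr_order prim_z).
  have nh : `|z ^+ h| = 1 by rewrite normrX norm_prim_root expr1n.
  transitivity (`|z ^+ h| * `|z ^+ (c - h) - 1|); last by rewrite nh mul1r.
  by rewrite -normrM mulrBr e mulr1 distrC.
apply: le_trans (P (c - h)%N _ _) _; [by rewrite subn_gt0 | | ].
  by rewrite -addnn; move: hgt; rewrite -addnn; lia.
by rewrite lerDr divr_ge0 ?ler0n.
Qed.

Let H : C := \sum_(1 <= h < c) h%:R^-1.

Lemma sum_ord_neq0 (F : nat -> C) :
  \sum_(a : 'I_c | a != 0) F a = \sum_(1 <= h < c) F h.
Proof.
have : \sum_(a : 'I_c) F a = \sum_(0 <= h < c) F h by rewrite big_mkord.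
by rewrite (bigD1 0)//= big_ltn// => /addrI.
Qed.

Lemma sum_geometric_bound :
  \sum_(a : 'I_c) geometric_bound c (root_char a) <= c%:R * (1 + 4 * H).
Proof.
rewrite (bigD1 0)//= /geometric_bound root_char_eq1 eqxx mulrDr mulr1 lerD2l.
have -> : c%:R * (4 * H) =
    \sum_(1 <= h < c) 2 * (c%:R / h%:R + c%:R / (c - h)%:R).
  rewrite -big_distrr big_split /= -!big_distrr /= -/H.
  rewrite [X in _ + _ * X]big_nat_rev /=.
  have -> : \sum_(1 <= h < c) (c - (1 + c - h.+1))%:R^-1 = H.
    rewrite /H big_nat [RHS]big_nat; apply: eq_bigr => h /andP[h0 hc].
    by congr (_%:R^-1); lia.
  by ring.
rewrite -(sum_ord_neq0 (fun h => 2 * (c%:R / h%:R + c%:R / (c - h)%:R))).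
apply: ler_sum => a a0; rewrite root_char_eq1 (negPf a0) ler_wpM2l ?ler0n//.
by apply: invr_norm_z_sub1; rewrite ltn_ord andbT lt0n.
Qed.

Lemma sum_gcd_div_norm :
  \sum_(a : 'I_c | a != 0) `|root_char a - 1|^-1 * (gcdn a c)%:R <=
  2 * c%:R * (size (divisors c))%:R * H.
Proof.
apply: (@le_trans _ _ (2 * c%:R * \sum_(1 <= h < c) (gcdn h c)%:R / h%:R)); last first.
  by rewrite -!mulrA !ler_wpM2l ?ler0n// sum_gcd_div_le.
have -> : 2 * c%:R * (\sum_(1 <= h < c) (gcdn h c)%:R / h%:R) =
  \sum_(1 <= h < c) (c%:R / h%:R + c%:R / (c - h)%:R) * (gcdn h c)%:R :> C.
  under [RHS]eq_bigr => h _ do rewrite mulrDl.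
  rewrite big_split /= [X in _ = _ + X]big_nat_rev /=.
  have -> : \sum_(1 <= h < c) c%:R / (c - (1 + c - h.+1))%:R * (gcdn (1 + c - h.+1) c)%:R =
     \sum_(1 <= h < c) c%:R / h%:R * (gcdn h c)%:R :> C.
    rewrite big_nat [RHS]big_nat; apply: eq_bigr => h /andP[h0 hc].
    have -> : (1 + c - h.+1 = c - h)%N by lia.
    rewrite (subKn (ltnW hc)); congr (_ * _%:R).
    have : gcdn (c - h) (c - h + h) = gcdn h (c - h + h).
      by rewrite gcdnDl gcdnDr gcdnC.
    by rewrite (subnK (ltnW hc)).
  rewrite -big_split big_distrr /=; apply: eq_bigr => h _; ring.
rewrite -(sum_ord_neq0 (fun h => (c%:R / h%:R + c%:R / (c - h)%:R) * (gcdn h c)%:R)).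
apply: ler_sum => a a0; rewrite ler_wpM2r ?ler0n//.
by apply: invr_norm_z_sub1; rewrite ltn_ord andbT lt0n.
Qed.

Lemma modular_hyperbola_discrepancy (beta : C) (s : nat) : 0 <= beta ->
    beta ^+ 4 = 2 * c%:R ^+ 3 * (size (divisors c))%:R ^+ 3 ->
  `|c%:R ^+ 2 * (\sum_(u : {unit 'I_c}) (val u + (val u)^-1%R < s)%N%:R) -
    (totient c)%:R * \sum_(0 <= x < c) \sum_(0 <= y < c) (x + y < s)%N%:R| <=
  8 * beta * c%:R ^+ 2 * (size (divisors c))%:R * H * (1 + 4 * H).
Proof.
move=> b0 b4.
pose f (x y : 'I_c) : C := (x + y < s)%N%:R.
(* The weights come from [norm_triangle_sum] with w = chi(-m) and v = chi(-n): the quotient w / v =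
   chi(-(m - n)) accounts for the argument m - n of [G]. *)
have key := @inverse_graph_discrepancy _ _ _ root_charD norm_root_char root_char_orth f
  (fun a => `|root_char a - 1|^-1) (fun a => geometric_bound c (root_char a))
  (fun a => (gcdn a c)%:R) beta.
rewrite card_unit_Zp card_ord in key.
have H0 : 0 <= H by apply: sumr_ge0 => h _; rewrite invr_ge0 ler0n.
have -> : \sum_(0 <= x < c) \sum_(0 <= y < c) (x + y < s)%N%:R =
    \sum_x \sum_y f x y.
  by rewrite big_mkord; apply: eq_bigr => x _; rewrite big_mkord.
apply: le_trans (key _ _ _ _ b0 _ _) _.
- by move=> x y; rewrite /f addnC.
- by move=> a; rewrite invr_ge0.
- by move=> a; rewrite /geometric_bound; case: ifP => _; rewrite ?ler0n ?divr_ge0.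
- by move=> a; rewrite ler0n.
- move=> m n n0; rewrite /fourier.
  have -> : \sum_x \sum_y f x y * root_char (- (m * x + n * y)) =
      \sum_(0 <= x < c) \sum_(0 <= y < c) (x + y < s)%N%:R *
        (root_char (- m) ^+ x * root_char (- n) ^+ y).
    rewrite big_mkord; apply: eq_bigr => x _; rewrite big_mkord.
    apply: eq_bigr => y _; rewrite -!root_char_mul -root_charD; congr (_ * root_char _); ring.
  have nN a : `|root_char (- a) - 1| = `|root_char a - 1|.
    transitivity (`|root_char (- a)| * `|root_char a - 1|); last by rewrite norm_root_char mul1r.
    by rewrite -normrM mulrBr -root_charD mulr1 addNr distrC (_ : root_char 0 = 1)// /root_char expr0.
  have gN a : geometric_bound c (root_char (- a)) = geometric_bound c (root_char a).
    by rewrite /geometric_bound !root_char_eq1 oppr_eq0 nN.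
  have n1 : root_char (- n) != 1 by rewrite root_char_eq1 oppr_eq0.
  apply: le_trans (norm_triangle_sum s _ n1 (norm_root_char _) (norm_root_char _)) _.
    by rewrite -exprM mulnC exprM (prim_expr_order prim_z) expr1n.
  have -> : root_char (- m) / root_char (- n) = root_char (- (m - n)).
    have cn0 : root_char (- n) != 0 by rewrite -normr_eq0 norm_root_char oner_neq0.
    by apply: (mulIf cn0); rewrite mulfVK// -root_charD; congr root_char; ring.
  by rewrite !gN nN mulrC.
- by move=> m n _; apply: kloosterman_le.
have -> : 8 * beta * c%:R ^+ 2 * (size (divisors c))%:R * H * (1 + 4 * H) =
  4 * beta * (c%:R * (1 + 4 * H)) * (2 * c%:R * (size (divisors c))%:R * H).
  by ring.
apply: ler_pM.
- rewrite !mulr_ge0// sumr_ge0// => a _; rewrite /geometric_bound.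
  by case: ifP => _; rewrite ?ler0n ?divr_ge0.
- by rewrite sumr_ge0// => a _; rewrite mulr_ge0 ?invr_ge0 ?ler0n.
- by rewrite ler_wpM2l ?mulr_ge0// sum_geometric_bound.
- exact: sum_gcd_div_norm.
Qed.

End ModularKloosterman.

(** * The primitive root exp(2 pi i / c) and its distance to 1 *)

Section RootOfUnity.
Variable R : realType.

Lemma sin_ge_half (x : R) : 0 <= x <= pi / 2 -> x / 2 <= sin x.
Proof.
move=> /andP[x0 xpi].
have pi0 := pi_gt0 R.
have y0 : 0 <= x / 2 by rewrite divr_ge0.
have ypi : x / 2 <= pi / 4 by lra.
have k2 : cos (pi / 4) ^+ 2 = 2^-1 :> R.
  have : cos ((pi / 4 : R) *+ 2) = 0.
    by rewrite (_ : _ *+ 2 = pi / 2) ?cos_pihalf// mulr2n; field.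
  by rewrite cos_mulr2n mulr2n; lra.
have k0 : 0 <= cos (pi / 4 : R) by apply: cos_ge0_pihalf; lra.
have cosle t : 0 <= t <= x / 2 -> cos (pi / 4) <= cos t.
  move=> /andP[t0 tx]; have tI : t \in `[0, pi]%R by rewrite in_itv /=; lra.
  have qI : (pi / 4 : R) \in `[0, pi]%R by rewrite in_itv /=; lra.
  by rewrite leNgt ltr_cos// -leNgt; lra.
have hs : cos (pi / 4) * (x / 2) <= sin (x / 2).
  have cs : {within `[0, x / 2]%classic, continuous (@sin R)}%classic.
    by apply: continuous_subspaceT; exact: continuous_sin.
  have [t] := MVT_segment y0 (fun t _ => is_derive_sin t) cs.
  rewrite in_itv /= sin0 !subr0 => tx ->.
  by rewrite ler_wpM2r// cosle.
(* sin x = 2 sin (x/2) cos (x/2), and both factors are bounded below in terms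
   of cos (pi/4), whose square is 1/2. *)
have -> : sin x = 2 * (cos (x / 2) * sin (x / 2)).
  have -> : sin x = sin (x / 2 *+ 2) by congr sin; rewrite mulr2n; field.
  by rewrite sin_mulr2n mulr2n; ring.
have hc := cosle (x / 2); rewrite y0 lexx in hc; have {}hc := hc isT.
have : cos (pi / 4) * (cos (pi / 4) * (x / 2)) <= cos (x / 2) * sin (x / 2).
  by rewrite ler_pM// mulr_ge0.
by rewrite mulrA -expr2 k2; lra.
Qed.

Definition root_of_unity (c : nat) : R[i] :=
  Complex (cos (pi *+ 2 / c%:R)) (sin (pi *+ 2 / c%:R)).

Lemma root_of_unity_exp c h : root_of_unity c ^+ h =
  Complex (cos (pi *+ 2 / c%:R * h%:R)) (sin (pi *+ 2 / c%:R * h%:R)).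
Proof.
elim: h => [|h IH]; first by rewrite expr0 mulr0 cos0 sin0.
rewrite exprSr IH /root_of_unity -natr1 mulrDr mulr1 cosD sinD.
by apply/eqP; rewrite eq_complex /= eqxx /=; apply/eqP; rewrite addrC.
Qed.

(** The modulus is 2 sin(pi h / c), which [sin_ge_half] makes at least pi h / c; the condition 2 h
    <= c keeps the angle within [0, pi / 2]. *)
Lemma norm_root_of_unity_sub1 (c h : nat) : (0 < h)%N -> (h.*2 <= c)%N ->
  h%:R <= c%:R * `|root_of_unity c ^+ h - 1|.
Proof.
move=> h0 hc; have c0 : 0 < c%:R :> R by rewrite ltr0n; lia.
rewrite root_of_unity_exp normc_def /= subr0.
set t := pi *+ 2 / c%:R * h%:R.
have -> : h%:R = (h%:R : R)%:C%C :> R[i] by rewrite rmorph_nat.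
have -> : c%:R = (c%:R : R)%:C%C :> R[i] by rewrite rmorph_nat.
rewrite -rmorphM lecR -ler_pdivrMl// mulrC.
pose r : R := h%:R / c%:R.
have er : t / 2 = pi * r by rewrite /t /r mulr2n; field; lra.
have r0 : 0 <= r by exact: divr_ge0.
have rle : r <= 2^-1.
  rewrite ler_pdivrMr// -(@ler_pM2l _ 2)// mulrA mulfV// mul1r.
  by rewrite -natrM ler_nat mul2n.
have pi0 := pi_gt0 R.
have ht : 0 <= t / 2 <= pi / 2.
  by rewrite er; apply/andP; split; [rewrite mulr_ge0// ltW | rewrite ler_pM2l].
have -> : (cos t - 1) ^+ 2 + sin t ^+ 2 = (2 * sin (t / 2)) ^+ 2.
  have -> : t = t / 2 *+ 2 by rewrite mulr2n; field.
  rewrite (_ : t / 2 *+ 2 / 2 = t / 2); last by rewrite mulr2n; field.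
  rewrite cos_mulr2n sin_mulr2n !mulr2n.
  have := cos2Dsin2 (t / 2); set a := cos _; set b := sin _ => e.
  have -> : a ^+ 2 = 1 - b ^+ 2 by rewrite -e; ring.
  have ea : a ^+ 2 = 1 - b ^+ 2 by rewrite -e; ring.
  transitivity (4 * b ^+ 4 + 4 * a ^+ 2 * b ^+ 2); first by ring.
  by rewrite ea; ring.
have hs := sin_ge_half ht.
rewrite sqrtr_sqr ger0_norm; last by rewrite mulr_ge0//; lra.
have p2 := @pi_ge2 R.
have : r * 2 <= t / 2 by rewrite er mulrC ler_wpM2r.
by rewrite -/r; lra.
Qed.

(** The lower bound excludes z^h = 1 for 0 < h <= c / 2; for larger h < c it would imply z^(c - h) =
    1. *)
Lemma prim_root_of_unity c : (1 < c)%N -> c.-primitive_root (root_of_unity c).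
Proof.
move=> c1; have c0 : c%:R != 0 :> R by rewrite pnatr_eq0; lia.
have zc : root_of_unity c ^+ c = 1.
  by rewrite root_of_unity_exp mulfVK// cos2pi sin2pi.
have hle h : (0 < h)%N -> (h.*2 <= c)%N -> root_of_unity c ^+ h != 1.
  move=> h0 hc; apply/eqP => e; have := norm_root_of_unity_sub1 h0 hc.
  by rewrite e subrr normr0 mulr0 lern0 (gtn_eqF h0).
apply/andP; split; first by lia.
apply/forallP => -[i ic] /=; rewrite unity_rootE.
have [->|ne] := eqVneq i.+1 c; first by rewrite zc eqxx.
have [h2|h2] := leqP i.+1.*2 c; first by rewrite (negPf (hle _ _ h2)).
apply/eqP/negP => /eqP e.
have lt : (i.+1 < c)%N by rewrite ltn_neqAle ne ic.
have nz1 : root_of_unity c ^+ (c - i.+1) != 1 by apply: hle; lia.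
move/eqP: nz1; apply; by rewrite -[LHS]mul1r -e -exprD subnKC ?(ltnW lt)// zc.
Qed.

(** All quantities are real, so the complex inequality is pulled back along the embedding of [R]
    into [R[i]]. *)
Lemma modular_hyperbola_discrepancy_real c' (s : nat) (c := c'.+2) (beta : R)
    (H : R := \sum_(1 <= h < c) h%:R^-1) : 0 <= beta ->
    beta ^+ 4 = 2 * c%:R ^+ 3 * (size (divisors c))%:R ^+ 3 ->
  `|c%:R ^+ 2 * (\sum_(u : {unit 'I_c'.+2}) (val u + (val u)^-1%R < s)%N%:R) -
    (totient c)%:R * \sum_(0 <= x < c) \sum_(0 <= y < c) (x + y < s)%N%:R| <=
  8 * beta * c%:R ^+ 2 * (size (divisors c))%:R * H * (1 + 4 * H).
Proof.
move=> b0 b4; have c1 : (1 < c)%N by [].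
have := @modular_hyperbola_discrepancy _ c' _ (prim_root_of_unity c1)
  (@norm_root_of_unity_sub1 c) (beta%:C)%C s.
rewrite -/c ler0c => /(_ b0).
have cn n : n%:R = (n%:R : R)%:C%C :> R[i] by rewrite rmorph_nat.
rewrite [8]cn.
have -> : 2 * c%:R ^+ 3 * (size (divisors c))%:R ^+ 3 =
  (2 * c%:R ^+ 3 * (size (divisors c))%:R ^+ 3 : R)%:C%C :> R[i].
  by rewrite !(rmorphM, rmorphXn, rmorph_nat).
rewrite -rmorphXn b4 => /(_ erefl).
set N := \sum_(u : _) _; set A := \sum_(0 <= x < _) _; set H' := \sum_(1 <= h < c) (h%:R^-1 : R[i]).
have -> : N = (\sum_(u : {unit 'I_c'.+2}) (val u + (val u)^-1%R < s)%N%:R : R)%:C%C.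
  by rewrite rmorph_sum; apply: eq_bigr => u _; rewrite rmorph_nat.
have -> : A = (\sum_(0 <= x < c) \sum_(0 <= y < c) (x + y < s)%N%:R : R)%:C%C.
  rewrite rmorph_sum; apply: eq_bigr => x _; rewrite rmorph_sum.
  by apply: eq_bigr => y _; rewrite rmorph_nat.
have -> : H' = H%:C%C.
  by rewrite rmorph_sum; apply: eq_bigr => x _; rewrite fmorphV rmorph_nat.
rewrite !cn -!rmorphXn -!rmorphM -rmorphB -(rmorph1 (real_complex R)) -rmorphD -!rmorphM.
rewrite normc_def /= expr0n /= addr0 sqrtr_sqr.
by rewrite lecR.
Qed.

End RootOfUnity.

Local Open Scope classical_set_scope.
Local Open Scope ring_scope.

(** * The main term *)

Section Zeta2.
Variable R : realType.
Local Notation zeta2 := (riemann_zeta (2 : R)).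

Lemma series_riemannR2 N :
  series (riemannR (2 : R)) N = \sum_(1 <= k < N.+1) (k%:R ^+ 2)^-1.
Proof.
rewrite /series /= big_add1 /=; apply: eq_bigr => k _.
by rewrite /riemannR powR_mulrn.
Qed.

Lemma series_riemannR2_diff N M : (0 < N)%N -> (N <= M)%N ->
  series (riemannR (2 : R)) M <= series (riemannR (2 : R)) N + (N%:R^-1 - M%:R^-1).
Proof.
move=> N0 /subnK <-; elim: (M - N)%N => [|m IH]; first by rewrite subrr addr0.
rewrite addSn seriesSr.
apply: le_trans (lerD IH (_ : _ <= (m + N)%:R^-1 - (m + N).+1%:R^-1)) _; last by rewrite -addrA lerD2l addrA subrK.
set n := (m + N)%N; have n0 : 0 < n%:R :> R by rewrite ltr0n; lia.
rewrite /riemannR powR_mulrn// -natr1.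
have -> : n%:R^-1 - (n%:R + 1)^-1 = (n%:R * (n%:R + 1))^-1 :> R by field; lra.
by rewrite lef_pV2 ?posrE ?mulr_gt0 ?exprn_gt0//; nra.
Qed.

Lemma zeta2_tail N : (0 < N)%N ->
  0 <= zeta2 - \sum_(1 <= k < N.+1) (k%:R ^+ 2)^-1 <= N%:R^-1.
Proof.
move=> N0; rewrite -series_riemannR2 subr_ge0 lerBlDl; apply/andP; split.
  apply: nondecreasing_cvgn_le; last exact: is_cvg_riemann_zeta2.
  apply/nondecreasing_seqP => n; rewrite seriesSr lerDl.
  by rewrite /riemannR invr_ge0 powR_ge0.
apply: limr_le; first exact: is_cvg_riemann_zeta2.
near=> M; have NM : (N <= M)%N by near: M; exact: nbhs_infty_ge.
apply: le_trans (series_riemannR2_diff N0 NM) _.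
by rewrite lerD2l gerBl invr_ge0.
Unshelve. all: by end_near. Qed.

Lemma zeta2_ge1 : 1 <= zeta2.
Proof.
have /andP[+ _] := zeta2_tail (ltn0Sn 0).
by rewrite big_nat1 expr1n invr1 subr_ge0.
Qed.

End Zeta2.

Section OddSum.
Variable R : realType.

(** A bound strictly below 1 is what lets the induction in [totient_sum_asymptotic] close. *)
Lemma odd_three_halves_sum N : (0 < N)%N ->
  \sum_(1 <= j < N) (j.*2.+1%:R * Num.sqrt j.*2.+1%:R)^-1 <=
    3 / 4 :> R.
Proof.
move=> N0.
(* Telescoping: k^(-3/2) <= (k - 1)^(-1/2) - (k + 1)^(-1/2). *)
suff h : \sum_(1 <= j < N) (j.*2.+1%:R * Num.sqrt j.*2.+1%:R)^-1 <=
    (Num.sqrt 2)^-1 - (Num.sqrt N.*2%:R)^-1 :> R.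
  have s0 : 0 < Num.sqrt 2 :> R by rewrite sqrtr_gt0.
  have s2 : Num.sqrt 2 ^+ 2 = 2 :> R by rewrite sqr_sqrtr.
  have : (Num.sqrt 2)^-1 <= 3 / 4 :> R.
    by rewrite -[leLHS]mul1r ler_pdivrMr//; nra.
  apply: le_trans; apply: le_trans h _; rewrite gerBl invr_ge0; exact: sqrtr_ge0.
elim: N N0 => // -[|N] IH _; first by rewrite big_geq// subrr.
rewrite big_nat_recr//=; apply: le_trans (lerD (IH isT) (lexx _)) _.
rewrite -addrA lerD2l.
set k : R := N.+1.*2.+1%:R.
have k1 : 1 < k by rewrite ltr1n.
have -> : N.+1.*2%:R = k - 1 :> R by rewrite /k -[in RHS]natr1 addrK.
have -> : N.+2.*2%:R = k + 1 :> R by rewrite /k natr1.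
set m := Num.sqrt k; set a := Num.sqrt (k - 1); set b := Num.sqrt (k + 1).
have m0 : 0 < m by rewrite sqrtr_gt0; lra.
have a0 : 0 < a by rewrite sqrtr_gt0; lra.
have b0 : 0 < b by rewrite sqrtr_gt0; lra.
have m2 : m ^+ 2 = k by rewrite sqr_sqrtr; lra.
have a2 : a ^+ 2 = k - 1 by rewrite sqr_sqrtr; lra.
have b2 : b ^+ 2 = k + 1 by rewrite sqr_sqrtr; lra.
rewrite addrC lerBlDr [leRHS]addrC.
(* It remains to see that a b (a + b) <= 2 k m: here a b = sqrt(k^2 - 1) <= k, and a + b <= 2 m by
   concavity of the square root. *)
have -> : a^-1 - b^-1 = 2 / (a * b * (a + b)).
  have e : 2 = (b - a) * (a + b) by rewrite -[LHS](_ : b ^+ 2 - a ^+ 2 = 2); [ring|rewrite a2 b2; ring].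
  by rewrite e; field; rewrite ?gt_eqF//; lra.
have k0 : 0 < k by lra.
rewrite -[leLHS]mul1r ler_pdivrMr ?mulr_gt0//.
rewrite mulrAC ler_pdivlMr ?mulr_gt0 ?addr_gt0//.
have ab : a * b <= k by nra.
have abm : a + b <= 2 * m by nra.
rewrite mul1r.
have h := ler_pM (ltW (mulr_gt0 a0 b0)) (ltW (addr_gt0 a0 b0)) ab abm.
by rewrite (le_trans h)// mulrCA.
Qed.

End OddSum.

(** * Recovering the totient-weighted sum from its sum over all dilations *)

Section TotientInversion.
Variables (R : realType) (alpha : R -> R) (lambda C0 : R).
Hypothesis alpha_eq0 : forall t, t <= 1 -> alpha t = 0.
Hypothesis lambda_ge0 : 0 <= lambda.
Hypothesis sum_alpha : forall (N : nat) (x : R), 0 <= x <= N%:R ->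
  `|\sum_(0 <= n < N.+1) n%:R * alpha (x / n%:R) - lambda * riemann_zeta (2 : R) * x ^+ 2| <= C0 * x.

Definition totient_sum (N : nat) (x : R) :=
  \sum_(0 <= n < N.+1) (totient n)%:R * alpha (x / n%:R).

Lemma alpha_div_eq0 (x : R) (n : nat) : x <= n%:R -> alpha (x / n%:R) = 0.
Proof.
move=> xn; apply: alpha_eq0; case: n xn => [_|n xn]; first by rewrite invr0 mulr0.
by rewrite ler_pdivrMr ?ltr0n// mul1r.
Qed.

(* The terms with n >= x vanish, so N only has to be at least x. *)
Lemma totient_sum_widen N M (x : R) : x <= N%:R -> (N <= M)%N ->
  totient_sum M x = totient_sum N x.
Proof.
move=> xN NM; rewrite /totient_sum (@big_cat_nat _ _ _ N.+1)//=.
rewrite [X in _ + X]big1_seq ?addr0// => n /andP[_].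
rewrite mem_index_iota => /andP[Nn _].
by rewrite alpha_div_eq0 ?mulr0// (le_trans xN)// ler_nat ltnW.
Qed.

(** Grouping the pairs (k, b) by n = k b leaves sum_(b | n) phi(b) = n; products beyond N contribute
    nothing. *)
Lemma sum_totient_sum N (x : R) : 0 <= x <= N%:R ->
  \sum_(1 <= k < N.+1) totient_sum N (x / k%:R) =
  \sum_(0 <= n < N.+1) n%:R * alpha (x / n%:R).
Proof.
move=> /andP[x0 xN]; pose F (n : nat) : R := alpha (x / n%:R).
have F0 n : (N <= n)%N -> F n = 0.
  by move=> Nn; rewrite /F alpha_div_eq0// (le_trans xN)// ler_nat.
(* Since x / 0 is 0, the index 0 can be included freely. *)
have F00 : F 0%N = 0 by rewrite /F invr0 mulr0 alpha_eq0.
transitivity (\sum_(0 <= b < N.+1) (totient b)%:R * \sum_(0 <= k < N.+1) F (k * b)%N).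
  rewrite exchange_big /=; apply: eq_bigr => b _.
  rewrite [in RHS]big_ltn// mul0n F00 add0r big_distrr /=; apply: eq_bigr => k _.
  by rewrite /F natrM invfM mulrA.
transitivity (\sum_(0 <= b < N.+1) (totient b)%:R *
    \sum_(0 <= n < N.+1 | (b %| n)%N) F n).
  rewrite big_nat [RHS]big_nat; apply: eq_bigr => b /andP[_ bN].
  have [->|b0] := posnP b; first by rewrite !mul0r.
  congr (_ * _); rewrite -(sum_multiples F _ b0).
  have le : (N.+1 <= N.+1 * b)%N by rewrite leq_pmulr.
  rewrite (@big_cat_nat _ _ _ N.+1)//= [X in _ + X]big1_seq ?addr0// => n.
  by rewrite mem_index_iota => /and3P[_ Nn _]; rewrite F0// ltnW.
under eq_bigr => b _ do rewrite big_distrr big_mkcond /=.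
rewrite exchange_big /= big_nat [RHS]big_nat; apply: eq_bigr => n /andP[_ nN].
rewrite -big_mkcond -big_distrl -/(F n) /=.
have [->|n0] := posnP n; first by rewrite F00 !mulr0.
congr (_ * _).
rewrite -{2}(sum_totient_dvd n) -(big_mkord (fun d => (d %| n)%N) totient) natr_sum.
rewrite (@big_cat_nat _ _ _ n.+1)//= [X in _ + X]big1_seq ?addr0// => b.
by rewrite mem_index_iota => /and3P[/(dvdn_leq n0) bn + _]; rewrite ltnNge bn.
Qed.

Let zeta2 := riemann_zeta (2 : R).
Let err N x := totient_sum N x - lambda * x ^+ 2.

(** The terms lambda (x / k)^2 produce a truncated zeta(2). Its tail is at most 1 / N and x <= N, so
    the truncation costs at most lambda x. *)
Let sum_err N (x : R) : (0 < N)%N -> 0 <= x <= N%:R ->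
  `|\sum_(1 <= k < N.+1) err N (x / k%:R)| <= (C0 + lambda) * x.
Proof.
move=> N0 xN; have /andP[x0 xN'] := xN.
set S := \sum_(1 <= k < N.+1) (k%:R ^+ 2)^-1 : R.
have -> : \sum_(1 <= k < N.+1) err N (x / k%:R) =
    (\sum_(0 <= n < N.+1) n%:R * alpha (x / n%:R) - lambda * zeta2 * x ^+ 2) +
    lambda * x ^+ 2 * (zeta2 - S).
  rewrite /err sumrB sum_totient_sum//.
  have -> : \sum_(1 <= k < N.+1) lambda * (x / k%:R) ^+ 2 = lambda * x ^+ 2 * S.
    by rewrite big_distrr /=; apply: eq_bigr => k _; rewrite expr_div_n mulrA.
  by ring.
apply: le_trans (ler_normD _ _) _; rewrite mulrDl; apply: lerD; first exact: sum_alpha.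
have := zeta2_tail R N0; rewrite -/zeta2 -/S => /andP[z1 z2].
have p0 : 0 <= lambda * x ^+ 2 * (zeta2 - S).
  by apply: mulr_ge0 => //; apply: mulr_ge0 => //; exact: exprn_ge0.
rewrite (ger0_norm p0) -mulrA ler_wpM2l//.
rewrite expr2 -mulrA -[leRHS]mulr1 ler_wpM2l//.
apply: le_trans (ler_wpM2l x0 z2) _.
by rewrite ler_pdivrMr ?ltr0n// mul1r.
Qed.

Lemma sum_odd_even (V : nmodType) (f : nat -> V) N :
  \sum_(1 <= k < N.*2.+1) f k =
  \sum_(0 <= j < N) f j.*2.+1 + \sum_(1 <= k < N.+1) f k.*2.
Proof.
elim: N => [|N IH]; first by rewrite !big_geq ?addr0.
rewrite doubleS big_nat_recr//= big_nat_recr//= IH.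
rewrite [in RHS]big_nat_recr//= [X in _ = _ + X]big_nat_recr//= doubleS.
by rewrite addrACA !addrA.
Qed.

(** The even k at x are all the k at x / 2. Cutoff 2 N at x matches cutoff N at x / 2, and 3 / 2 is
    1 + 1 / 2. *)
Let sum_err_odd N (x : R) : (0 < N)%N -> 0 <= x <= N%:R ->
  `|\sum_(0 <= j < N) err N.*2 (x / j.*2.+1%:R)| <= 3 / 2 * (C0 + lambda) * x.
Proof.
move=> N0 /andP[x0 xN].
have N20 : (0 < N.*2)%N by rewrite double_gt0.
have xN2 : x <= N.*2%:R by apply: le_trans xN _; rewrite ler_nat -addnn leq_addr.
have h1 := @sum_err N.*2 x N20; rewrite x0 xN2 in h1; have {}h1 := h1 isT.
have x2N : 0 <= x / 2 <= N%:R.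
  by rewrite divr_ge0//= ler_pdivrMr// mulr_natr (le_trans xN2)// -muln2 natrM mulr_natr.
have h2 := sum_err N0 x2N.
have -> : \sum_(0 <= j < N) err N.*2 (x / j.*2.+1%:R) =
    \sum_(1 <= k < N.*2.+1) err N.*2 (x / k%:R) -
    \sum_(1 <= k < N.+1) err N (x / 2 / k%:R).
  rewrite sum_odd_even -addrA.
  have -> : \sum_(1 <= k < N.+1) err N.*2 (x / k.*2%:R) =
      \sum_(1 <= k < N.+1) err N (x / 2 / k%:R).
    rewrite big_nat [RHS]big_nat; apply: eq_bigr => k /andP[k0 _].
    rewrite /err -(muln2 k) natrM invfM mulrA [x / _ / _]mulrAC; congr (_ - _).
    apply: totient_sum_widen; last by rewrite -addnn leq_addr.
    have /andP[y0 yN] := x2N; apply: le_trans yN.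
    by rewrite ler_wpM2r// ler_pdivrMr ?ltr0n// ler_peMr// ler1n.
  by rewrite subrr addr0.
apply: le_trans (ler_normB _ _) _; apply: le_trans (lerD h1 h2) _; lra.
Qed.

Lemma totient_sum_asymptotic : exists2 C, 0 <= C &
  forall N (x : R), 0 <= x <= N%:R ->
  `|totient_sum N x - lambda * x ^+ 2| <= C * (x * Num.sqrt x).
Proof.
have C00 : 0 <= C0.
  have := @sum_alpha 1 1; rewrite ler01 lexx => /(_ isT).
  by move=> /(le_trans (normr_ge0 _)); rewrite mulr1.
(* With this choice the bound of [sum_err_odd] is a quarter of the target, and the odd k >= 3
   account for the other three quarters. *)
pose D := 6 * (C0 + lambda).
have D0 : 0 <= D by rewrite mulr_ge0// addr_ge0.
have lD : lambda <= D.
  by rewrite /D -[leLHS]mul1r; apply: ler_pM => //; rewrite ?ler1n ?lerDr.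
exists D => //.
(* Induction on the dyadic size of x: each odd k >= 3 takes x < 2^(n + 1) to x / k < 2^n. *)
suff h n : forall N (x : R), 0 <= x <= N%:R -> x < 2 ^+ n ->
    `|err N x| <= D * (x * Num.sqrt x).
  move=> N x hx; apply: (h N) => //; have /andP[_ xN] := hx.
  by apply: le_lt_trans xN _; rewrite -natrX ltr_nat ltn_expl.
have small N (x : R) : 0 <= x < 1 -> `|err N x| <= D * (x * Num.sqrt x).
  move=> /andP[x0 x1].
  have -> : err N x = - (lambda * x ^+ 2).
    rewrite /err /totient_sum big1 ?sub0r// => m _.
    case: m => [|m]; first by rewrite mul0r.
    by rewrite alpha_div_eq0 ?mulr0// (le_trans (ltW x1))// ler1n.
  rewrite normrN ger0_norm ?mulr_ge0 ?exprn_ge0//.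
  have sx : x <= Num.sqrt x.
    rewrite -{1}(sqr_sqrtr x0) expr2 ler_piMr ?sqrtr_ge0//.
    by rewrite -sqrtr1 ler_wsqrtr// ltW.
  apply: ler_pM => //; first exact: exprn_ge0.
  by rewrite expr2 ler_wpM2l.
elim: n => [N x /andP[x0 _]|n IH N x xN x2].
  by rewrite expr0 => x1; apply: small; rewrite x0.
have /andP[x0 xN'] := xN.
have [x1|x1] := ltP x 1; first by apply: small; rewrite x0.
have N0 : (0 < N)%N.
  by rewrite lt0n; apply: contraTneq xN' => ->; rewrite -ltNge (lt_le_trans ltr01).
have := sum_err_odd N0 xN; rewrite big_ltn// divr1.
have -> : err N.*2 x = err N x.
  by rewrite /err (totient_sum_widen xN')// -addnn leq_addr.
set S := \sum_(1 <= j < N) _ => h.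
have s0 := sqrtr_ge0 x.
have s1 : 1 <= Num.sqrt x by rewrite -[leLHS]sqrtr1 ler_wsqrtr.
have hS : `|S| <= 3 / 4 * (D * (x * Num.sqrt x)).
  apply: le_trans (ler_norm_sum _ _ _) _.
  apply: (@le_trans _ _ (\sum_(1 <= j < N)
      (D * (x * Num.sqrt x)) * (j.*2.+1%:R * Num.sqrt j.*2.+1%:R)^-1)).
    rewrite big_nat [leRHS]big_nat; apply: ler_sum => j /andP[j0 jN].
    have p0 : 0 < j.*2.+1%:R :> R by rewrite ltr0n.
    have xj : x / j.*2.+1%:R <= x by rewrite ler_pdivrMr// ler_peMr// ler1n.
    have := IH N.*2 (x / j.*2.+1%:R).
    rewrite divr_ge0//= => /(_ _ _)/le_trans; apply.
    - by rewrite (le_trans xj)// (le_trans xN')// ler_nat -addnn leq_addr.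
    - rewrite ltr_pdivrMr// (lt_le_trans x2)// exprS mulrC ler_wpM2l ?exprn_ge0//.
      by rewrite ler_nat ltnS double_gt0.
    - rewrite -[leRHS]mulrA ler_wpM2l// sqrtrM// sqrtrV ?ler0n// invfM mulrACA.
      by [].
  have X0 : 0 <= D * (x * Num.sqrt x) by apply: mulr_ge0; [|exact: mulr_ge0].
  rewrite -big_distrr /= [leLHS]mulrC ler_wpM2r//.
  exact: odd_three_halves_sum.
have : `|err N x| <= `|err N x + S| + `|S|.
  by rewrite -{1}(addrK S (err N x)) ler_normB.
have xs : x <= x * Num.sqrt x by rewrite ler_peMr.
have : 3 / 2 * (C0 + lambda) * x <= 1 / 4 * (D * (x * Num.sqrt x)).
  have -> : 1 / 4 * (D * (x * Num.sqrt x)) = 3 / 2 * (C0 + lambda) * (x * Num.sqrt x).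
    by rewrite /D; field.
  by rewrite ler_wpM2l// mulr_ge0// addr_ge0.
lra.
Qed.

End TotientInversion.

(** * Harmonic numbers and the density of the triangle *)

Section HarmonicSums.
Variable R : realType.

Definition harm (m : nat) : R := \sum_(1 <= n < m.+1) n%:R^-1.

Lemma harm_ge0 m : 0 <= harm m.
Proof. by apply: sumr_ge0 => n _; rewrite invr_ge0. Qed.

Lemma harmS m : harm m.+1 = harm m + m.+1%:R^-1.
Proof. by rewrite /harm big_nat_recr. Qed.

Lemma harm_le_nat m : harm m <= m%:R.
Proof.
elim: m => [|m IH]; first by rewrite /harm big_geq.
by rewrite harmS -[leRHS]natr1 lerD// invf_le1 ?ltr0n// ler1n.
Qed.

Lemma ln_succ_diff (m : nat) : (0 < m)%N ->
  m.+1%:R^-1 <= ln (m.+1%:R : R) - ln m%:R <= m%:R^-1.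
Proof.
move=> m0; have p : 0 < m%:R :> R by rewrite ltr0n.
have p1 : 0 < m.+1%:R :> R by rewrite ltr0n.
apply/andP; split.
  rewrite -lerN2 opprB -ln_div ?posrE//.
  have -> : m%:R / m.+1%:R = 1 + - m.+1%:R^-1 :> R.
    by rewrite -natr1; field; rewrite natr1 gt_eqF.
  apply: le_ln1Dx; rewrite ltrN2 invf_lt1//.
  by rewrite ltr1n ltnS.
rewrite -ln_div ?posrE//.
have -> : m.+1%:R / m%:R = 1 + m%:R^-1 :> R.
  by rewrite -natr1; field; rewrite gt_eqF.
by apply: le_ln1Dx; rewrite (lt_trans (ltrN10 R))// invr_gt0.
Qed.

(** The sequence harm m - ln m decreases, by at most 1 / k - 1 / (k + 1) at step k. Only differences
    are controlled, so Euler's constant never has to be introduced. *)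
Lemma harm_ln_diff (m n : nat) : (0 < m)%N -> (m <= n)%N ->
  0 <= (harm m - ln m%:R) - (harm n - ln n%:R) <= m%:R^-1.
Proof.
move=> m0 mn.
suff : 0 <= (harm m - ln m%:R) - (harm n - ln n%:R) <= m%:R^-1 - n%:R^-1.
  by move=> /andP[-> h]; apply: le_trans h _; rewrite gerBl invr_ge0.
rewrite -(subnK mn); elim: (n - m)%N => [|k IH]; first by rewrite !subrr lexx.
rewrite addSn harmS.
have km : (0 < k + m)%N by rewrite addn_gt0 m0 orbT.
have /andP[] := ln_succ_diff km.
move: IH => /andP[].
move: (harm m - ln _) (harm (k + m)) (ln (k + m)%:R) (ln (k + m).+1%:R).
move: (m%:R^-1) ((k + m)%:R^-1) ((k + m).+1%:R^-1) => a b c d e f g *.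
by apply/andP; split; lra.
Qed.

Definition pos_part (u : R) := Num.max u 0.

(** Exactly the n <= m can contribute, and there n (x / n - j)^2 = x^2 / n - 2 j x + j^2 n. *)
Lemma sum_pos_part (j N : nat) (x : R) : (0 < j)%N -> 0 <= x <= N%:R ->
  let m := Num.truncn (x / j%:R) in
  \sum_(0 <= n < N.+1) n%:R * pos_part (x / n%:R - j%:R) ^+ 2 =
  x ^+ 2 * harm m - 2 * j%:R * x * m%:R + j%:R ^+ 2 * (m%:R * (m%:R + 1) / 2).
Proof.
move=> j0 /andP[x0 xN] m.
have pj : 0 < j%:R :> R by rewrite ltr0n.
have y0 : 0 <= x / j%:R by rewrite divr_ge0.
have /andP[m1 m2] := truncn_itv y0; rewrite -/m in m1 m2.
have mN : (m <= N)%N.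
  rewrite -(ler_nat R) (le_trans m1)// (le_trans _ xN)// ler_pdivrMr//.
  by rewrite ler_peMr// ler1n.
rewrite (@big_cat_nat _ _ _ m.+1)//= [X in _ + X]big1_seq ?addr0; last first.
  move=> n /andP[_]; rewrite mem_index_iota => /andP[mn _].
  have n0 : 0 < n%:R :> R by rewrite ltr0n (leq_trans _ mn).
  rewrite /pos_part max_r ?expr0n ?mulr0// subr_le0 ler_pdivrMr// -ler_pdivrMl//.
  by rewrite mulrC (le_trans (ltW m2))// ler_nat.
rewrite big_ltn// mul0r add0r.
have xm : j%:R * m%:R <= x by rewrite mulrC -ler_pdivlMr.
elim: m {m1 m2 mN} xm => [|m IH] xm.
  by rewrite /harm !big_geq// !mulr0 !mul0r mulr0 subrr addr0.
have xm' : j%:R * m%:R <= x by apply: le_trans xm; rewrite ler_pM2l// ler_nat.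
rewrite big_nat_recr//= IH// harmS.
have p : 0 < m.+1%:R :> R by rewrite ltr0n.
rewrite /pos_part max_l; last by rewrite subr_ge0 ler_pdivlMr.
by move: p; rewrite -natr1 => p; field; rewrite gt_eqF.
Qed.

(** With d = x - m j in [0, j], substituting m = (x - d) / j turns the last two terms of
    [sum_pos_part] into (-2 + 1/2) x^2 plus terms of size O(x). *)
Lemma sum_pos_part_approx (j N : nat) (x : R) : (0 < j <= 3)%N -> 0 <= x <= N%:R ->
  `|\sum_(0 <= n < N.+1) n%:R * pos_part (x / n%:R - j%:R) ^+ 2 -
    x ^+ 2 * (harm (Num.truncn (x / j%:R)) - 3 / 2)| <= 8 * x.
Proof.
move=> /andP[j0 j3] xN; rewrite sum_pos_part//; have /andP[x0 _] := xN.
have pj : 0 < j%:R :> R by rewrite ltr0n.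
have pj3 : j%:R <= 3 :> R by rewrite ler_nat.
have y0 : 0 <= x / j%:R by rewrite divr_ge0.
have /andP[] := truncn_itv y0; set m := Num.truncn _.
rewrite ler_pdivlMr// ltr_pdivrMr// -natr1 => m1 m2.
have m0 : 0 <= m%:R :> R by [].
move: (harm m) (m%:R : R) (j%:R : R) m0 pj pj3 m1 m2 => h M J m0 pj pj3 m1 m2.
pose d := x - M * J.
have eM : M = (x - d) / J by rewrite /d; field; lra.
have -> : x ^+ 2 * h - 2 * J * x * M + J ^+ 2 * (M * (M + 1) / 2) -
    x ^+ 2 * (h - 3 / 2) = x * d + d ^+ 2 / 2 + J * x / 2 - J * d / 2.
  by rewrite eM; field; lra.
have d0 : 0 <= d by rewrite /d; lra.
have dJ : d <= J by rewrite /d; lra.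
have dx : d <= x by rewrite /d; have := mulr_ge0 m0 (ltW pj); lra.
have h1 : x * d <= x * 3 by rewrite ler_wpM2l//; lra.
have h2 : d ^+ 2 <= 3 * x by rewrite expr2 ler_pM//; lra.
have h3 : J * x <= 3 * x by rewrite ler_wpM2r.
have h4 : J * d <= 3 * x by rewrite ler_pM//; lra.
have h5 := mulr_ge0 x0 d0; have h6 := mulr_ge0 (ltW pj) d0.
have h7 := mulr_ge0 (ltW pj) x0; have h8 := sqr_ge0 d.
by rewrite ler_norml; lra.
Qed.

(** Three errors arise, from truncating x, from truncating y and from [harm_ln_diff]; each is at
    most 1 / floor(y) <= 2 / y. *)
Lemma harm_truncn_ln (x y : R) : 1 <= y -> y <= x ->
  `|(harm (Num.truncn x) - ln x) - (harm (Num.truncn y) - ln y)| <= 6 / y.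
Proof.
move=> y1 yx; have y0 : 0 <= y by lra.
have x0 : 0 <= x by lra.
have P (t : R) : 1 <= t -> ((0 < Num.truncn t)%N *
    (0 <= ln t - ln (Num.truncn t)%:R <= (Num.truncn t)%:R^-1))%type.
  move=> t1; have t0 : 0 <= t by lra.
  have /andP[] := truncn_itv t0.
  have : (0 < Num.truncn t)%N by rewrite truncn_ge_nat.
  move: (Num.truncn t) => m m0 m1 m2; split=> //.
  have pm : 0 < m%:R :> R by rewrite ltr0n.
  have pt : 0 < t by lra.
  rewrite subr_ge0 ler_ln ?posrE ?ltr0n// m1 /=.
  have /andP[_] := ln_succ_diff m0 => h; apply: le_trans _ h.
  by rewrite lerD2r ler_ln ?posrE ?ltr0n// ltW.
have [m0 /andP[a1 a2]] := P y y1.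
have [n0 /andP[b1 b2]] := P x (le_trans y1 yx).
have mn : (Num.truncn y <= Num.truncn x)%N by apply: le_truncn.
have /andP[c1 c2] := harm_ln_diff m0 mn.
have my : (Num.truncn y)%:R^-1 <= 2 / y.
  have /andP[_ m2] := truncn_itv y0.
  have p : 0 < (Num.truncn y)%:R :> R by rewrite ltr0n.
  rewrite ler_pdivlMr; last by lra.
  rewrite mulrC ler_pdivrMr//; move: m2; rewrite -natr1.
  have : 1 <= (Num.truncn y)%:R :> R by rewrite ler1n.
  by lra.
have nm : (Num.truncn x)%:R^-1 <= (Num.truncn y)%:R^-1 :> R.
  by rewrite lef_pV2 ?posrE ?ltr0n// ler_nat.
have -> : 6 / y = 3 * (2 / y) by rewrite mulrA; congr (_ / _); ring.
move: my nm a1 a2 b1 b2 c1 c2; move: (2 / y) (_^-1) (_^-1) => u v w *.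
by rewrite ler_norml; apply/andP; split; lra.
Qed.

(* The area of {0 <= u, v <= 1, u + v <= t - 1}: for t = Q / b this is the
   proportion of [0, b]^2 where u + v <= Q - b. *)
Definition triangle_density (t : R) : R :=
  (pos_part (t - 1) ^+ 2 - 2 * pos_part (t - 2) ^+ 2 + pos_part (t - 3) ^+ 2) / 2.

Lemma triangle_density_eq0 t : t <= 1 -> triangle_density t = 0.
Proof.
by move=> t1; rewrite /triangle_density /pos_part !max_r; lra.
Qed.

Lemma ln_four_thirds : 0 <= ln (4 / 3 : R) <= 1 / 3.
Proof.
apply/andP; split; first by rewrite ln_ge0//; lra.
have -> : 4 / 3 = 1 + 1 / 3 :> R by field.
by apply: le_ln1Dx; lra.
Qed.

(** The weights 1, -2, 1 cancel the constant -3/2 and the common part of the harmonic numbers,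
    leaving ln x - 2 ln(x / 2) + ln(x / 3) = ln(4 / 3). *)
Lemma sum_triangle_density (N : nat) (x : R) : 0 <= x <= N%:R ->
  `|\sum_(0 <= n < N.+1) n%:R * triangle_density (x / n%:R) -
    ln (4 / 3) / 2 * x ^+ 2| <= 60 * x.
Proof.
move=> xN; have /andP[x0 _] := xN.
pose S j := \sum_(0 <= n < N.+1) n%:R * pos_part (x / n%:R - j%:R) ^+ 2.
have -> : \sum_(0 <= n < N.+1) n%:R * triangle_density (x / n%:R) =
    (S 1%N - 2 * S 2%N + S 3%N) / 2.
  rewrite /S big_distrr /= -sumrB -big_split /= big_distrl /=.
  by apply: eq_bigr => n _; rewrite /triangle_density; ring.
have h1 := @sum_pos_part_approx 1 N x isT xN.
have h2 := @sum_pos_part_approx 2 N x isT xN.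
have h3 := @sum_pos_part_approx 3 N x isT xN.
rewrite -/(S 1%N) in h1; rewrite -/(S 2%N) in h2; rewrite -/(S 3%N) in h3; move: (S 1%N) (S 2%N) (S 3%N) h1 h2 h3 => s1 s2 s3 h1 h2 h3.
rewrite divr1 in h1.
(* Below 3 the argument x / 3 of [harm_truncn_ln] would drop under 1, but there x^2 <= 3 x makes
   every term O(x). *)
have [x3|x3] := ltP x 3.
  have hm j : (0 < j)%N -> 0 <= harm (Num.truncn (x / j%:R)) <= 3.
    move=> j0; rewrite harm_ge0 /=; apply: le_trans (harm_le_nat _) _.
    have pj : 0 < j%:R :> R by rewrite ltr0n.
    have y0 : 0 <= x / j%:R by rewrite divr_ge0.
    have /andP[m1 _] := truncn_itv y0; apply: le_trans m1 _.
    by rewrite ler_pdivrMr// (le_trans (ltW x3))// ler_peMr// ler1n.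
  have xx : 0 <= x ^+ 2 <= 3 * x.
    by rewrite exprn_ge0//= expr2 ler_wpM2r//; lra.
  have /andP[x20 x23] := xx.
  have q (h : R) : 0 <= h <= 3 -> `|x ^+ 2 * (h - 3 / 2)| <= 9 / 2 * x.
    move=> h03; rewrite normrM ger0_norm//.
    have -> : 9 / 2 * x = 3 * x * (3 / 2) by field.
    by rewrite ler_pM//; rewrite ler_norml; lra.
  move: h1 h2 h3; have := q _ (hm 1%N isT); have := q _ (hm 2%N isT); have := q _ (hm 3%N isT).
  rewrite divr1; move: (x ^+ 2 * _) (x ^+ 2 * _) (x ^+ 2 * _) => a b c.
  rewrite !ler_norml => *.
  have /andP[l0 l1] := ln_four_thirds.
  have kx : ln (4 / 3) / 2 * x ^+ 2 <= 1 / 6 * (3 * x) by rewrite ler_pM//; lra.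
  have kx0 : 0 <= ln (4 / 3) / 2 * x ^+ 2 by rewrite mulr_ge0//; lra.
  by apply/andP; split; lra.
have pos_x : 0 < x by lra.
have e2 : ln (x / 2) = ln x - ln 2 by rewrite ln_div ?posrE//.
have e3 : ln (x / 3) = ln x - ln 3 by rewrite ln_div ?posrE//.
have e43 : ln (4 / 3) = ln 2 + ln 2 - ln 3 :> R.
  by rewrite ln_div ?posrE// -lnM ?posrE//; congr (ln _ - _); ring.
have g1 : 1 <= x / 2 by lra.
have g2 : x / 2 <= x by lra.
have g3 : 1 <= x / 3 by lra.
have g4 : x / 3 <= x / 2 by lra.
have B1 := harm_truncn_ln g1 g2; have B2 := harm_truncn_ln g3 g4.
have r1 : 6 / (x / 2) = 12 / x by field; lra.
have r2 : 6 / (x / 3) = 18 / x by field; lra.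
rewrite r1 e2 in B1; rewrite r2 e2 e3 in B2; move: B1 B2.
rewrite e43 !ler_norml.
move: (harm (Num.truncn x)) (harm (Num.truncn (x / 2))) (harm (Num.truncn (x / 3))) h1 h2 h3 => k1 k2 k3 h1 h2 h3 B1 B2.
set B := k1 - 2 * k2 + k3 - (ln 2 + ln 2 - ln 3).
have hB : `|B| <= 30 / x.
  have -> : 30 / x = 12 / x + 18 / x by field; lra.
  move: B1 B2; rewrite /B; move: (12 / x) (18 / x) => u v *.
  by rewrite ler_norml; lra.
have : `|x ^+ 2 * B| <= 30 * x.
  rewrite normrM ger0_norm ?exprn_ge0//.
  apply: le_trans (ler_wpM2l _ hB) _; rewrite ?exprn_ge0// le_eqVlt.
  by apply/orP; left; apply/eqP; field; lra.
move: h1 h2 h3; rewrite /B !ler_norml => *.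
by apply/andP; split; lra.
Qed.

End HarmonicSums.

(** * Averages of the divisor function and lattice points of triangles *)

Section DivisorSums.
Variable R : realType.

Lemma count_multiples l Q : (0 < l)%N ->
  (\sum_(1 <= c < Q.+1) (l %| c) = Q %/ l)%N.
Proof.
move=> l0; elim: Q => [|Q IH]; first by rewrite big_geq// div0n.
by rewrite big_nat_recr//= IH divnS// addnC.
Qed.

Lemma size_divisorsE c Q : (0 < c <= Q)%N ->
  (size (divisors c) = \sum_(1 <= g < Q.+1) (g %| c))%N.
Proof.
move=> /andP[c0 cQ]; rewrite -sum1_size.
transitivity (\sum_(1 <= g < Q.+1 | g %| c) 1)%N; last first.
  by rewrite big_mkcond; apply: eq_bigr => g _; case: (g %| c)%N.
rewrite -[RHS]big_filter; apply: perm_big; rewrite perm_sym.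
apply: uniq_perm => [||d]; [exact: filter_uniq (iota_uniq _ _)|exact: divisors_uniq|].
 rewrite mem_filter mem_index_iota -dvdn_divisors//.
case dc: (d %| c)%N => //=; rewrite ltnS (dvdn_gt0 c0 dc) /=.
by rewrite (leq_trans (dvdn_leq c0 dc)).
Qed.

Lemma sum_invr_multiples e Q : (0 < e)%N ->
  \sum_(1 <= a < Q.+1 | (e %| a)%N) a%:R^-1 <= harm R Q / e%:R.
Proof.
move=> e0; have le : (Q.+1 <= Q.+1 * e)%N by rewrite leq_pmulr.
apply: (@le_trans _ _ (\sum_(0 <= a < Q.+1 * e | (e %| a)%N) a%:R^-1)).
  rewrite [leRHS](@big_cat_nat _ _ _ Q.+1)//= [X in _ <= X + _]big_ltn_cond//.
  rewrite dvdn0 invr0 add0r lerDl sumr_ge0// => i _; exact: invr_ge0.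
rewrite (sum_multiples (fun a => a%:R^-1) _ e0) big_ltn// mul0n invr0 add0r.
rewrite /harm big_distrl /=; apply: ler_sum => j _.
by rewrite natrM invfM.
Qed.

(** The square counts pairs (a, b) of divisors, and at most Q gcd(a, b) / (a b) integers up to Q are
    multiples of both. Bounding the gcd by the sum of common divisors e separates a from b: each e
    contributes e (harm Q / e)^2. *)
Lemma sum_size_divisors_sqr Q :
  \sum_(1 <= c < Q.+1) (size (divisors c))%:R ^+ 2 <= Q%:R * harm R Q ^+ 3.
Proof.
have h0 := harm_ge0 R Q.
have -> : \sum_(1 <= c < Q.+1) (size (divisors c))%:R ^+ 2 =
   \sum_(1 <= a < Q.+1) \sum_(1 <= b < Q.+1) (Q %/ lcmn a b)%N%:R :> R.
  transitivity (\sum_(1 <= c < Q.+1) \sum_(1 <= a < Q.+1) \sum_(1 <= b < Q.+1)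
      (lcmn a b %| c)%N%:R : R).
    rewrite big_nat [RHS]big_nat; apply: eq_bigr => c hc.
    rewrite (size_divisorsE hc) natr_sum expr2 big_distrlr /=.
    apply: eq_bigr => a _; apply: eq_bigr => b _.
    by rewrite dvdn_lcm -natrM mulnb.
  rewrite exchange_big /= big_nat [RHS]big_nat; apply: eq_bigr => a /andP[a0 _].
  rewrite exchange_big /= big_nat [RHS]big_nat; apply: eq_bigr => b /andP[b0 _].
  by rewrite -natr_sum count_multiples// lcmn_gt0 a0.
apply: (@le_trans _ _ (\sum_(1 <= a < Q.+1) \sum_(1 <= b < Q.+1)
   Q%:R * \sum_(1 <= e < Q.+1) e%:R * (((e %| a)%N%:R / a%:R) * ((e %| b)%N%:R / b%:R)))).
  rewrite big_nat [leRHS]big_nat; apply: ler_sum => a /andP[a0 aQ].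
  rewrite big_nat [leRHS]big_nat; apply: ler_sum => b /andP[b0 bQ].
  have pa : 0 < a%:R :> R by rewrite ltr0n.
  have pb : 0 < b%:R :> R by rewrite ltr0n.
  have g0 : (0 < gcdn a b)%N by rewrite gcdn_gt0 a0.
  have pg : 0 < (gcdn a b)%:R :> R by rewrite ltr0n.
  apply: (@le_trans _ _ (Q%:R * ((gcdn a b)%:R * (a%:R^-1 * b%:R^-1)))).
    have l0 : (0 < lcmn a b)%N by rewrite lcmn_gt0 a0.
    rewrite -invfM -natrM -muln_lcm_gcd natrM invfM.
    rewrite [(gcdn a b)%:R * _]mulrC -[_^-1 * _ * _]mulrA mulVf ?gt_eqF// mulr1.
    by rewrite ler_pdivlMr ?ltr0n// -natrM ler_nat leq_divM.
  rewrite ler_wpM2l// (bigD1_seq (gcdn a b))/= ?iota_uniq ?mem_index_iota//; last first.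
    by rewrite g0 ltnS (leq_trans (dvdn_leq a0 (dvdn_gcdl _ _))).
  by rewrite dvdn_gcdl dvdn_gcdr !mul1r lerDl sumr_ge0.
under eq_bigr => a _ do rewrite -big_distrr /=.
rewrite -big_distrr /= ler_wpM2l//.
under eq_bigr => a _ do rewrite exchange_big /=.
rewrite exchange_big /= [X in _ <= X]exprSr {2}/harm big_distrr /=.
rewrite big_nat [leRHS]big_nat; apply: ler_sum => e /andP[e0 _].
have pe : 0 < e%:R :> R by rewrite ltr0n.
under eq_bigr => a _ do rewrite -big_distrr -big_distrr /=.
rewrite -big_distrr -big_distrl /=.
have -> : \sum_(1 <= a < Q.+1) (e %| a)%N%:R / a%:R =
    \sum_(1 <= a < Q.+1 | (e %| a)%N) a%:R^-1 :> R.
  rewrite [RHS]big_mkcond; apply: eq_bigr => a _.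
  by case: ifP; rewrite ?mul1r ?mul0r.
set T : R := \sum_(1 <= a < Q.+1 | (e %| a)%N) a%:R^-1.
have T0 : 0 <= T by apply: sumr_ge0 => a _; rewrite invr_ge0.
have hT : T <= harm R Q / e%:R := sum_invr_multiples Q e0.
apply: (@le_trans _ _ (e%:R * (harm R Q / e%:R * (harm R Q / e%:R)))).
  by rewrite ler_wpM2l// ler_pM.
rewrite le_eqVlt; apply/orP; left; apply/eqP; field; lra.
Qed.

End DivisorSums.

Section TriangleCount.
Variable R : realType.

Definition triangular (s : nat) : R := s%:R * (s%:R + 1) / 2.

Lemma sum_subn (c s : nat) :
  \sum_(0 <= x < c) (s - x)%N%:R = triangular s - triangular (s - c).
Proof.
elim: c => [|c IH]; first by rewrite big_geq// subn0 subrr.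
rewrite big_nat_recr//= IH subnS /triangular.
case: (s - c)%N => [|u] /=; first by ring.
by rewrite -natr1; field.
Qed.

(** Inclusion and exclusion: from the full triangle remove the corners x >= c and y >= c, then
    restore their overlap. Truncated subtraction covers all s at once. *)
Lemma triangle_count (c s : nat) :
  \sum_(0 <= x < c) \sum_(0 <= y < c) (x + y < s)%N%:R =
  triangular s - 2 * triangular (s - c) + triangular (s - c - c).
Proof.
have inner x : \sum_(0 <= y < c) (x + y < s)%N%:R =
    (s - x)%N%:R - (s - c - x)%N%:R :> R.
  elim: c => [|c IH]; first by rewrite big_geq// subn0 subrr.
  rewrite big_nat_recr//= IH subnS.
  have -> : (x + c < s)%N = (0 < s - c - x)%N by rewrite !subn_gt0 ltn_subRL addnC.
  have -> : ((s - c).-1 - x = (s - c - x).-1)%N by lia.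
  case: (s - c - x)%N => [|u] /=; first by rewrite addr0.
  by rewrite -[u.+1%:R]natr1; ring.
under eq_bigr => x _ do rewrite inner.
rewrite sumrB !sum_subn; ring.
Qed.

Lemma triangular_approx (Q c j : nat) : (0 < Q)%N ->
  `|triangular (Q.+1 - j * c) - pos_part (Q%:R - (j * c)%N%:R) ^+ 2 / 2| <=
  5 / 2 * Q%:R.
Proof.
move=> Q0; have q1 : 1 <= Q%:R :> R by rewrite ler1n.
have [h|h] := leqP (j * c) Q.
  rewrite subSn// /pos_part max_l ?subr_ge0 ?ler_nat// -natrB//.
  have : (Q - j * c)%N%:R <= Q%:R :> R by rewrite ler_nat leq_subr.
  have : 0 <= (Q - j * c)%N%:R :> R by [].
  rewrite /triangular -natr1; move: (_ - _)%N%:R => u u0 uQ.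
  by rewrite ler_norml; apply/andP; split; lra.
have -> : (Q.+1 - j * c = 0)%N by apply/eqP; rewrite subn_eq0.
rewrite /pos_part max_r ?subr_le0 ?ler_nat ?(ltnW h)// /triangular.
by rewrite ler_norml; apply/andP; split; lra.
Qed.

(** Scaling by c^2 turns the three squares into those of Q - j c for j = 1, 2, 3. The errors from
    [triangular_approx], weighted 1, 2, 1, add up to 10 Q. *)
Lemma triangle_density_approx (Q c : nat) : (0 < Q)%N -> (0 < c)%N ->
  `|\sum_(0 <= x < c) \sum_(0 <= y < c) (x + y < Q.+1 - c)%N%:R -
    c%:R ^+ 2 * triangle_density (Q%:R / c%:R)| <= 10 * Q%:R :> R.
Proof.
move=> Q0 c0; have pc : 0 < c%:R :> R by rewrite ltr0n.
rewrite triangle_count.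
have p j : c%:R ^+ 2 * pos_part (Q%:R / c%:R - j%:R) ^+ 2 =
    pos_part (Q%:R - (j * c)%N%:R) ^+ 2 :> R.
  rewrite -exprMn; congr (_ ^+ 2); rewrite /pos_part maxr_pMr ?ltW// mulr0.
  by rewrite mulrBr mulrCA mulfV ?gt_eqF// mulr1 natrM [c%:R * _]mulrC.
have -> : c%:R ^+ 2 * triangle_density (Q%:R / c%:R) =
   (pos_part (Q%:R - (1 * c)%N%:R) ^+ 2 - 2 * pos_part (Q%:R - (2 * c)%N%:R) ^+ 2
     + pos_part (Q%:R - (3 * c)%N%:R) ^+ 2) / 2 :> R.
  by rewrite -!p /triangle_density; ring.
have h1 := triangular_approx c 1 Q0.
have h2 := triangular_approx c 2 Q0.
have h3 := triangular_approx c 3 Q0.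
have -> : (Q.+1 - c - c - c = Q.+1 - 3 * c)%N by lia.
have -> : (Q.+1 - c - c = Q.+1 - 2 * c)%N by lia.
have -> : (Q.+1 - c = Q.+1 - 1 * c)%N by lia.
move: h1 h2 h3; rewrite !ler_norml => *; apply/andP; split; lra.
Qed.

End TriangleCount.

(** * Saturated Farey fractions as points of modular hyperbolas *)

Lemma unit_Zp_coprime c' (u : {unit 'I_c'.+2}) : coprime (val u) c'.+2.
Proof.
have := valP u; rewrite -(natr_Zp (val u)).
by rewrite (@unitZpE c'.+2)// coprime_sym natr_Zp.
Qed.

Lemma unit_Zp_gt0 c' (u : {unit 'I_c'.+2}) : (0 < val u)%N.
Proof.
have := unit_Zp_coprime u; by case: (val u) => -[|n].
Qed.

Lemma unit_Zp_mulV c' (u : {unit 'I_c'.+2}) :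
  (val u * (val u)^-1%R = 1 %[mod c'.+2])%N.
Proof. by have := congr1 val (mulrV (valP u)) => /= ->; rewrite modn_small. Qed.

Lemma unit_Zp_invP c' (u : {unit 'I_c'.+2}) (e : nat) :
  (val u * e = 1 %[mod c'.+2])%N -> (e = (val u)^-1%R %[mod c'.+2])%N.
Proof.
move=> h.
have : val u * e%:R = 1 :> 'I_c'.+2.
  apply: val_inj; rewrite /= Zp_nat /= modnMmr h; by rewrite modn_small.
move=> h2; have {}h2 : e%:R = (val u)^-1 :> 'I_c'.+2.
  by rewrite -[LHS](mulKr (valP u)) h2 mulr1.
by rewrite -h2 Zp_nat /= modn_mod.
Qed.

Lemma det_mx2 (A : comNzRingType) (M : 'M[A]_2) : \det M = M 0 0 * M 1 1 - M 0 1 * M 1 0.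
Proof.
rewrite (expand_det_row _ 0) !big_ord_recl big_ord0 addr0.
rewrite /cofactor !det_mx11 !mxE /= expr0 mul1r.
rewrite !addn1 ?expr1 mulN1r mulrN.
by congr (_ * M _ _ - M _ _ * M _ _); apply: val_inj.
Qed.

Lemma tr_mx2 (A : comNzRingType) (M : 'M[A]_2) : \tr M = M 0 0 + M 1 1.
Proof.
by rewrite /mxtrace !big_ord_recl big_ord0 addr0; congr (_ + M _ _); apply: val_inj.
Qed.

(** The modulus is written c' + 2 so that the ordinals form a nontrivial ring; denominator 1 gives
    only the fraction 1 and is treated apart. *)
Definition hyperbola_pairs (c' s : nat) : nat :=
  #|[set u : {unit 'I_c'.+2} | (val u + (val u)^-1%R < s)%N]%SET|.

Lemma saturated_farey_unit (Q c' : nat) (u : {unit 'I_c'.+2}) :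
  (val u + (val u)^-1%R < Q.+1 - c'.+2)%N ->
  saturated_farey Q ((val u : nat)%:R / c'.+2%:R).
Proof.
set d : nat := val u; set e : nat := (val u)^-1%R => hQ.
have d0 : (0 < d)%N := unit_Zp_gt0 u.
have dlt : (d < c'.+2)%N := ltn_ord _.
have elt : (e < c'.+2)%N := ltn_ord _.
have h : (d * e = 1 %[mod c'.+2])%N := unit_Zp_mulV u.
have de1 : (d * e = (d * e) %/ c'.+2 * c'.+2 + 1)%N.
  by rewrite {1}(divn_eq (d * e) c'.+2) h modn_small.
set f := ((d * e) %/ c'.+2)%N in de1.
set c := c'.+2 in hQ h dlt elt de1 *.
(* The determinant is (c + e) d - c (d + f) = d e - f c = 1, and the trace c + e + d is at most Q by
   [hQ]. *)
pose M : 'M[int]_2 := \matrix_(i < 2, j < 2)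
  (if i == 0 then (if j == 0 then (c + e)%N else c)
   else (if j == 0 then (d + f)%N else d))%:Z.
exists M; last by rewrite /Psi !mxE /= !pmulrn.
split; last by rewrite tr_mx2 !mxE /=; lia.
rewrite /saturated_mx /= det_mx2 !mxE /=.
have fe : (f <= e)%N.
  rewrite -(leq_pmul2r (isT : (0 < c)%N)); apply: (@leq_trans (d * e)).
    by rewrite de1 leq_addr.
  by rewrite mulnC leq_mul2l ltnW ?orbT.
by split; lia.
Qed.

Lemma saturated_farey1 (Q : nat) : (3 <= Q)%N -> saturated_farey Q 1.
Proof.
move=> Q3; pose M : 'M[int]_2 := \matrix_(i < 2, j < 2)
  (if i == 0 then (if j == 0 then 2 else 1) else 1).
exists M; last by rewrite /Psi !mxE /= divff.
split; last by rewrite tr_mx2 !mxE /=; lia.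
by rewrite /saturated_mx /= det_mx2 !mxE /=.
Qed.

(** For b >= 2 the determinant makes a an inverse of d modulo b. Hence a is congruent to e < b, and
    a >= b forces a >= b + e, so the trace condition gives d + e <= Q - b. *)
Lemma saturated_farey_inv (Q : nat) (q : rat) : saturated_farey Q q ->
  (q = 1 /\ (3 <= Q)%N) \/ exists c' (u : {unit 'I_c'.+2}),
    (val u + (val u)^-1%R < Q.+1 - c'.+2)%N /\
    q = (val u : nat)%:R / c'.+2%:R.
Proof.
move=> [M [[detM ab bd d1 [ac cd]] trM] <-].
rewrite det_mx2 in detM; rewrite tr_mx2 in trM; rewrite /Psi.
move: (M 0 0) (M 0 1) (M 1 0) (M 1 1) detM ab bd d1 ac cd trM.
move=> a' b' c_ d' detM ab bd d1 ac cd trM {M}.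
have nat_of (x : int) : 0 <= x -> exists n : nat, x = n%:Z.
  by move=> x0; exists `|x|%N; rewrite gez0_abs.
have [d ed] : exists n : nat, d' = n%:Z by apply: nat_of; lia.
have [b eb] : exists n : nat, b' = n%:Z by apply: nat_of; lia.
have [a ea] : exists n : nat, a' = n%:Z by apply: nat_of; lia.
have [c ec] : exists n : nat, c_ = n%:Z by apply: nat_of; lia.
rewrite ea eb ec ed in detM ab bd d1 ac cd trM *; clear ea eb ec ed nat_of.
have {}detM : (d * a = b * c + 1)%N by lia.
have {}ab : (b <= a)%N by lia.
have {}bd : (d <= b)%N by lia.
have {}d1 : (0 < d)%N by lia.
have {}trM : (a + d <= Q)%N by lia.
have {}cd : (d <= c)%N by lia.
clear ac.
case: b detM ab bd => [|[|c']] detM ab bd; first by lia.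
  left; have d1' : d = 1%N by lia.
  by rewrite d1' divff//; split=> //; lia.
right; have cop : coprime d c'.+2.
  apply/coprimeP => //; exists (a, c) => /=; rewrite mulnC detM.
  by rewrite [(c * _)%N]mulnC addKn.
have db : (d < c'.+2)%N.
  rewrite ltn_neqAle bd andbT; apply/eqP => e.
  by move: cop; rewrite e /coprime gcdnn.
have ud : (inord d : 'I_c'.+2) \is a GRing.unit.
  have -> : inord d = d%:R :> 'I_c'.+2.
    by apply: val_inj; rewrite Zp_nat /= inordK// modn_small.
  by rewrite (@unitZpE c'.+2)// coprime_sym.
exists c', (FinRing.unit _ ud).
have vu : val (FinRing.unit _ ud) = d :> nat by rewrite /= inordK.
set u := FinRing.unit _ _ in vu *; rewrite vu; split=> //.
have ha : (a = (val u)^-1%R %[mod c'.+2])%N.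
  by apply: unit_Zp_invP; rewrite vu detM mulnC modnMDl.
set e : nat := (val u)^-1%R in ha *.
have elt : (e < c'.+2)%N := ltn_ord _.
have e0 : (0 < e)%N.
  have := unit_Zp_mulV u; rewrite -/e; case: (e) => // /eqP.
  by rewrite muln0 mod0n modn_small.
rewrite [(e %% _)%N]modn_small// in ha.
have := divn_eq a c'.+2; rewrite ha.
have : (0 < a %/ c'.+2)%N by rewrite divn_gt0.
clear - trM; nia.
Qed.

Lemma saturated_farey_inj c1 c2 (u1 : {unit 'I_c1.+2}) (u2 : {unit 'I_c2.+2}) :
  (val u1 : nat)%:R / c1.+2%:R = (val u2 : nat)%:R / c2.+2%:R :> rat ->
  c1 = c2 /\ val u1 = val u2 :> nat.
Proof.
move=> /eqP; rewrite eqr_div ?pnatr_eq0// -!natrM eqr_nat => /eqP e.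
have cp1 := unit_Zp_coprime u1; have cp2 := unit_Zp_coprime u2.
have d12 : (c1.+2 %| c2.+2)%N.
  by rewrite -(Gauss_dvdr _ (n := val u1)) 1?coprime_sym// e dvdn_mull.
have d21 : (c2.+2 %| c1.+2)%N.
  by rewrite -(Gauss_dvdr _ (n := val u2)) 1?coprime_sym// -e dvdn_mull.
have ec : c1.+2 = c2.+2 by apply/eqP; rewrite eqn_dvd d12 d21.
split; first by case: ec.
move: e; move: (nat_of_ord (val u1)) (nat_of_ord (val u2)) => n1 n2 /eqP.
by rewrite ec eqn_pmul2r// => /eqP.
Qed.

Lemma card_fset_set_seq (T : choiceType) (A : set T) (s : seq T) : uniq s ->
  (forall x, A x <-> x \in s) -> #|` fset_set A| = size s.
Proof.
move=> us As; have -> : A = [set` seq_fset tt s].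
  by apply/seteqP; split => x; rewrite /mkset seq_fsetE => /As.
by rewrite set_fsetK size_seq_fset undup_id.
Qed.

(** The fraction 1 accounts for the first summand; the others are listed without repetition by
    dependent pairs of a modulus between 2 and Q and a unit. *)
Lemma card_saturated_fareyE (Q : nat) : card_saturated_farey Q =
  ((3 <= Q) + \sum_(c' < Q.-1) hyperbola_pairs c' (Q.+1 - c'.+2))%N.
Proof.
pose T := {c' : 'I_Q.-1 & {unit 'I_c'.+2}}.
pose P (x : T) :=
  (val (tagged x) + (val (tagged x))^-1%R < Q.+1 - (tag x).+2)%N.
pose F (x : T) : rat := (val (tagged x) : nat)%:R / (tag x).+2%:R.
pose L : seq rat := (if (3 <= Q)%N then [:: 1] else [::]) ++
  [seq F x | x <- enum P].
have F1 x : F x != 1.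
  have c0 : (tag x).+2%:R != 0 :> rat by rewrite pnatr_eq0.
  apply/eqP => /(congr1 ( *%R^~ (tag x).+2%:R)); rewrite /F divfK// mul1r => /eqP.
  by rewrite eqr_nat => /eqP h; have := ltn_ord (val (tagged x)); rewrite h ltnn.
have uL : uniq L.
  rewrite cat_uniq map_inj_uniq ?enum_uniq ?andbT; last first.
    move=> [x u] [y v]; rewrite /F /= => /saturated_farey_inj[exy euv].
    have {}exy : x = y by apply: val_inj.
    by subst y; congr existT; apply: val_inj; apply: val_inj.
  case: ifP => _ //=; apply/hasP => -[_ /mapP[x _ ->]] //.
  by rewrite inE (negPf (F1 x)).
rewrite /card_saturated_farey (@card_fset_set_seq _ _ L)//; last first.
  move=> q; rewrite mem_cat; split.
      move=> /saturated_farey_inv [[-> ->]|]; first by rewrite inE eqxx.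
      move=> [c' [u [hQ ->]]]; apply/orP; right.
      have hc : (c' < Q.-1)%N by lia.
      apply/mapP; exists (existT _ (Ordinal hc) u : T) => //.
      by rewrite mem_enum.
    move=> /orP[|/mapP[x + ->]].
      by case: ifP => // Q3; rewrite inE => /eqP ->; exact: saturated_farey1.
    by rewrite mem_enum; exact: saturated_farey_unit.
rewrite size_cat size_map -cardE; congr (_ + _)%N; first by case: ifP.
rewrite -sum1_card.
rewrite (eq_bigl (fun x : T => predT (tag x) && P x))//.
rewrite -(@sig_big_dep _ _ _ 'I_Q.-1 (fun i => {unit 'I_i.+2}) predT (fun i (u : {unit 'I_i.+2}) =>
  (val u + (val u)^-1%R < Q.+1 - i.+2)%N) (fun i u => 1%N)) /=.
by apply: eq_bigr => i _; rewrite sum1dep_card.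
Qed.

(** * The asymptotic formula *)

Section SaturatedFareyCount.
Variable R : realType.
Local Notation harm := (harm R).
Local Notation alpha := (@triangle_density R).
Local Notation d c := ((size (divisors c))%:R : R).

Lemma size_divisors_ge1 c : (0 < c)%N -> 1 <= d c.
Proof.
move=> c0; rewrite ler1n.
have : (1 \in divisors c)%N by rewrite -dvdn_divisors// dvd1n.
by case: (divisors c).
Qed.

Lemma harm_le m n : (m <= n)%N -> harm m <= harm n.
Proof.
move=> mn; rewrite /harm [leRHS](@big_cat_nat _ _ _ m.+1)//= lerDl.
by apply: sumr_ge0 => i _; rewrite invr_ge0.
Qed.

(** The fourth root of 2 c^3 tau(c)^3 is at most 2 Q^(3/4) tau(c). The lattice point error 10 Q
    carries the weight phi(c) / c^2 <= 1 / c. *)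
Lemma hyperbola_pairs_approx (Q c' : nat) (c := c'.+2) : (c <= Q)%N ->
  `|(hyperbola_pairs c' (Q.+1 - c))%:R - (totient c)%:R * alpha (Q%:R / c%:R)| <=
  16 * Q%:R `^ (3 / 4) * d c ^+ 2 * harm Q * (1 + 4 * harm Q) + 10 * Q%:R / c%:R.
Proof.
move=> cQ; have Q0 : (0 < Q)%N by apply: leq_trans cQ.
have pc : 0 < c%:R :> R by rewrite ltr0n.
have d1 : 1 <= d c by exact: size_divisors_ge1.
pose b : R := (2 * c%:R ^+ 3 * d c ^+ 3) `^ 4^-1.
have base0 : 0 <= 2 * c%:R ^+ 3 * d c ^+ 3 :> R by rewrite !mulr_ge0 ?exprn_ge0.
have b0 : 0 <= b := powR_ge0 _ _.
have b4 : b ^+ 4 = 2 * c%:R ^+ 3 * d c ^+ 3.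
  by rewrite -powR_mulrn// -powRrM mulVf// powRr1.
pose q := Q%:R `^ (3 / 4) : R.
have q0 : 0 <= q := powR_ge0 _ _.
have q4 : q ^+ 4 = Q%:R ^+ 3.
  by rewrite -powR_mulrn// -powRrM divfK// powR_mulrn.
have bq : b <= 2 * q * d c.
  rewrite -(@ler_pXn2r _ 4)// ?nnegrE ?mulr_ge0// b4 !exprMn q4.
  have -> : (2 : R) ^+ 4 * Q%:R ^+ 3 * d c ^+ 4 = 2 * Q%:R ^+ 3 * d c ^+ 3 * (8 * d c) by ring.
  apply: (@le_trans _ _ (2 * Q%:R ^+ 3 * d c ^+ 3)).
    rewrite ler_wpM2r ?exprn_ge0// ler_wpM2l// lerXn2r ?nnegrE//.
    by rewrite ler_nat.
  by rewrite ler_peMr ?mulr_ge0 ?exprn_ge0//; lra.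
have := modular_hyperbola_discrepancy_real (Q.+1 - c) b0 b4.
rewrite -/c; set A := \sum_(0 <= x < c) _; set H := \sum_(1 <= h < c) _.
have -> : \sum_(u : {unit 'I_c'.+2}) (val u + (val u)^-1%R < Q.+1 - c)%N%:R =
    (hyperbola_pairs c' (Q.+1 - c))%:R :> R.
  rewrite -natr_sum /hyperbola_pairs -sum1dep_card [in RHS]big_mkcond /=.
  by congr _%:R; apply: eq_bigr => u _; case: (_ < _)%N.
set N := (hyperbola_pairs _ _)%:R; set phi := (totient c)%:R.
have HQ : H <= harm Q by rewrite -[H]/(harm c'.+1) harm_le// ltnW.
have H0 : 0 <= H by apply: sumr_ge0 => i _; rewrite invr_ge0.
move=> h1.
have h2 := @triangle_density_approx R Q c Q0 isT; rewrite -/A in h2.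
have -> : N - phi * alpha (Q%:R / c%:R) =
    (c%:R ^+ 2 * N - phi * A) / c%:R ^+ 2 +
    phi / c%:R ^+ 2 * (A - c%:R ^+ 2 * alpha (Q%:R / c%:R)).
  by field; rewrite gt_eqF.
apply: le_trans (ler_normD _ _) _; apply: lerD.
  have c2 : 0 < c%:R ^+ 2 :> R by rewrite exprn_gt0.
  rewrite normrM [X in _ * X]ger0_norm ?invr_ge0 ?exprn_ge0// ler_pdivrMr//.
  apply: le_trans h1 _.
  have -> : 8 * b * c%:R ^+ 2 * d c * H * (1 + 4 * H) =
    b * (8 * d c * (H * (1 + 4 * H)) * c%:R ^+ 2) by ring.
  have -> : 16 * q * d c ^+ 2 * harm Q * (1 + 4 * harm Q) * c%:R ^+ 2 =
    (2 * q * d c) * (8 * d c * (harm Q * (1 + 4 * harm Q)) * c%:R ^+ 2) by ring.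
  have e0 : 0 <= H * (1 + 4 * H) by rewrite mulr_ge0//; lra.
  have e1 : H * (1 + 4 * H) <= harm Q * (1 + 4 * harm Q) by rewrite ler_pM//; lra.
  apply: ler_pM => //; first by rewrite mulr_ge0 ?exprn_ge0// mulr_ge0.
  by rewrite ler_wpM2r ?exprn_ge0// ler_wpM2l// mulr_ge0.
rewrite normrM ger0_norm ?divr_ge0 ?exprn_ge0//.
have p1 : phi / c%:R ^+ 2 <= c%:R^-1.
  rewrite ler_pdivrMr ?exprn_gt0// expr2 mulrA mulVf ?gt_eqF// mul1r ler_nat.
  rewrite totient_count_coprime big_mkord -[leqRHS]card_ord -sum1_card.
  by apply: leq_sum => i _; exact: leq_b1.
rewrite mulrC; apply: ler_pM => //.
by rewrite divr_ge0 ?exprn_ge0.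
Qed.

Lemma card_saturated_farey_totient_sum (Q : nat) : (0 < Q)%N ->
  `|(card_saturated_farey Q)%:R - totient_sum alpha Q Q%:R| <=
  101 * (Q%:R `^ (7 / 4) * harm Q ^+ 5).
Proof.
move=> Q0; have q1 : 1 <= Q%:R :> R by rewrite ler1n.
have h1 : 1 <= harm Q.
  have := harm_le Q0; rewrite {1}/harm big_nat1 invr1; exact.
have h0 : 0 <= harm Q by lra.
pose q : R := Q%:R `^ (3 / 4).
have q0 : 0 <= q := powR_ge0 _ _.
have e74 : Q%:R `^ (7 / 4) = Q%:R * q :> R.
  rewrite /q -{2}(powRr1 (ler0n R Q)) -powRD; last by rewrite pnatr_eq0 -lt0n Q0 implybT.
  by congr (_ `^ _); field.
have q1' : 1 <= q by rewrite -(powRr0 Q%:R) ler_powR//; lra.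
rewrite card_saturated_fareyE natrD natr_sum /totient_sum.
rewrite big_ltn// mul0r add0r big_ltn// divr1 mul1r.
have -> : \sum_(2 <= n < Q.+1) (totient n)%:R * alpha (Q%:R / n%:R) =
    \sum_(c' < Q.-1) (totient c'.+2)%:R * alpha (Q%:R / c'.+2%:R).
  rewrite -(prednK Q0) big_add1 big_add1 /= big_mkord.
  by apply: eq_bigr => i _; rewrite prednK.
rewrite opprD addrACA -sumrB; apply: le_trans (ler_normD _ _) _.
(* For modulus 1 the triangle contains the single lattice point (0, 0), so [alpha] at Q is within 10
   Q of 1. *)
have b1 : `|(2 < Q)%N%:R - alpha Q%:R| <= 1 + 10 * Q%:R.
  have := @triangle_density_approx R Q 1 Q0 isT.
  rewrite !big_nat1 subn1 /= addn0 Q0 expr1n mul1r divr1 !ler_norml.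
  by case: (2 < Q)%N => /= *; apply/andP; split; lra.
have b2 : `|\sum_(c' < Q.-1) ((hyperbola_pairs c' (Q.+1 - c'.+2))%:R -
    (totient c'.+2)%:R * alpha (Q%:R / c'.+2%:R))| <=
    80 * (Q%:R * q * harm Q ^+ 5) + 10 * Q%:R * harm Q.
  apply: le_trans (ler_norm_sum _ _ _) _.
  pose B c : R := 16 * q * harm Q * (1 + 4 * harm Q) * d c ^+ 2 + 10 * Q%:R * c%:R^-1.
  have B0 c : 0 <= B c.
    by rewrite addr_ge0// ?mulr_ge0 ?exprn_ge0 ?invr_ge0//; lra.
  apply: (@le_trans _ _ (\sum_(c' < Q.-1) B c'.+2)).
    apply: ler_sum => i _.
    have iQ : (i.+2 <= Q)%N by rewrite -ltn_predRL.
    apply: le_trans (hyperbola_pairs_approx iQ) _.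
    by rewrite /B le_eqVlt; apply/orP; left; apply/eqP; rewrite -/q; ring.
  apply: (@le_trans _ _ (\sum_(1 <= c < Q.+1) B c)).
    rewrite [leRHS]big_ltn// ler_wpDl// big_add1 /= big_add1 /=.
    by rewrite big_mkord.
  rewrite /B big_split /= -!big_distrr /=; apply: lerD => //.
  apply: le_trans (ler_wpM2l _ (sum_size_divisors_sqr R Q)) _.
    by rewrite !mulr_ge0//; lra.
  (* The factor 80 is 16 times 5, as 1 + 4 harm Q <= 5 harm Q. *)
  have -> : 80 * (Q%:R * q * harm Q ^+ 5) =
    16 * q * harm Q * (5 * harm Q) * (Q%:R * harm Q ^+ 3) by ring.
  by rewrite ler_wpM2r ?mulr_ge0 ?exprn_ge0// ler_wpM2l ?mulr_ge0//; lra.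
apply: le_trans (lerD b1 b2) _; rewrite e74.
have h5 : harm Q <= harm Q ^+ 5 by rewrite ler_eXnr.
have s1 : Q%:R * harm Q <= Q%:R * q * harm Q ^+ 5.
  by rewrite -mulrA ler_wpM2l// (le_trans h5)// ler_peMl// exprn_ge0.
have s2 : Q%:R <= Q%:R * harm Q by rewrite ler_peMr.
lra.
Qed.

Lemma harm_le_ln Q : (0 < Q)%N -> harm Q <= 1 + ln Q%:R.
Proof.
move=> Q0; have /andP[+ _] := @harm_ln_diff R 1 Q isT Q0.
by rewrite {1}/harm big_nat1 invr1 ln1; lra.
Qed.

(** The inequality ln y < y at y = Q^del gives ln Q <= Q^del / del. *)
Lemma harm_le_powR (del : R) Q : 0 < del -> (0 < Q)%N ->
  harm Q <= (1 + del^-1) * Q%:R `^ del.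
Proof.
move=> d0 Q0; apply: le_trans (harm_le_ln Q0) _.
have q1 : 1 <= Q%:R :> R by rewrite ler1n.
have p1 : 1 <= Q%:R `^ del by have := ler_powR q1 (ltW d0); rewrite powRr0.
rewrite mulrDl mul1r lerD// mulrC ler_pdivlMr// mulrC -ln_powR ltW//.
by apply: ln_sublinear; lra.
Qed.

Lemma card_saturated_farey_asymptotic : exists2 C : R, 0 <= C &
  forall Q : nat, (0 < Q)%N ->
  `|(card_saturated_farey Q)%:R -
    Q%:R ^+ 2 / (2 * riemann_zeta (2 : R)) * ln (4 / 3)| <=
  C * (Q%:R `^ (7 / 4) * harm Q ^+ 5).
Proof.
have z1 := zeta2_ge1 R.
have z0 : riemann_zeta (2 : R) != 0 by rewrite gt_eqF//; lra.
pose lambda : R := ln (4 / 3) / 2 / riemann_zeta 2.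
have /andP[l0 _] := ln_four_thirds R.
have lambda0 : 0 <= lambda by rewrite !divr_ge0//; lra.
have hG (N : nat) (x : R) : 0 <= x <= N%:R ->
    `|\sum_(0 <= n < N.+1) n%:R * alpha (x / n%:R) -
      lambda * riemann_zeta (2 : R) * x ^+ 2| <= 60 * x.
  by move=> xN; rewrite /lambda divfK//; exact: sum_triangle_density.
have [C C0 hC] := totient_sum_asymptotic (@triangle_density_eq0 R) lambda0 hG.
exists (101 + C); first by rewrite addr_ge0.
move=> Q Q0; have q1 : 1 <= Q%:R :> R by rewrite ler1n.
have h1 : 1 <= harm Q.
  have := harm_le Q0; rewrite {1}/harm big_nat1 invr1; exact.
have -> : Q%:R ^+ 2 / (2 * riemann_zeta (2 : R)) * ln (4 / 3) = lambda * Q%:R ^+ 2.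
  by rewrite /lambda; field.
have := hC Q Q%:R; rewrite ler0n lexx => /(_ isT) k2.
have k1 := card_saturated_farey_totient_sum Q0.
rewrite -(subrKA (totient_sum alpha Q Q%:R)).
apply: le_trans (ler_normD _ _) _; rewrite mulrDl; apply: lerD => //.
apply: le_trans k2 _; rewrite ler_wpM2l//.
have s74 : Q%:R * Num.sqrt Q%:R <= Q%:R `^ (7 / 4) :> R.
  rewrite -powR12_sqrt// -{1}(powRr1 (ler0n R Q)) -powRD; last first.
    by rewrite pnatr_eq0 -lt0n Q0 implybT.
  by rewrite ler_powR//; lra.
by apply: le_trans s74 _; rewrite ler_peMr ?powR_ge0// exprn_ege1.
Qed.

End SaturatedFareyCount.

Theorem corollary2 (R : realType) (eps : R) (eps_gt0 : 0 < eps) :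
  (fun Q : nat => (card_saturated_farey Q)%:R : R) =
  (fun Q : nat => Q%:R ^+ 2 / (2 * riemann_zeta (2 : R)) * ln (4 / 3 : R))
  +O_\oo (fun Q : nat => Q%:R `^ (7 / 4 + eps) : R).
Proof.
have [C C0 hC] := card_saturated_farey_asymptotic R.
(* The fifth power of the harmonic number then costs exactly Q^eps, with a constant depending only
   on [eps]. *)
pose del := eps / 5; have del0 : 0 < del by rewrite divr_gt0.
apply/eqaddOP; near=> k; near=> Q.
have Q0 : (0 < Q)%N by near: Q; exact: nbhs_infty_gt.
apply: le_trans (hC Q Q0) _; rewrite ger0_norm ?powR_ge0//.
have q0 : Q%:R != 0 :> R by rewrite pnatr_eq0 -lt0n.
apply: (@le_trans _ _ (C * (1 + del^-1) ^+ 5 * Q%:R `^ (7 / 4 + eps))).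
  rewrite -mulrA ler_wpM2l// powRD ?q0 ?implybT// [leRHS]mulrCA ler_wpM2l ?powR_ge0//.
  have -> : eps = del * 5 by rewrite /del divfK.
  rewrite powRrM powR_mulrn ?powR_ge0// -exprMn lerXn2r ?nnegrE ?harm_ge0//.
    by rewrite mulr_ge0 ?powR_ge0// addr_ge0// invr_ge0 ltW.
  exact: harm_le_powR.
by rewrite ler_wpM2r ?powR_ge0//; near: k; exact: nbhs_pinfty_ge.
Unshelve. all: by end_near. Qed.
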